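(* Let $\mu\in\Gamma_\alpha$ for some $\alpha\in(0,\infty)$, and suppose that the greatest common divisor of the support of $\mu$ is equal to one. If $\alpha>1/2$, then $G_\mu$ almost surely has one component, while if $\alpha<1/2$, then $G_\mu$ almost surely has infinitely many components.
   Context: $\mathbb{N}=\{1,2,\ldots\}$. A function $L:(0,\infty)\to(0,\infty)$ is slowly varying if $\lim_{u\to\infty} L(u(1+r))/L(u)=1$ for every $r>0$. For $\alpha\in(0,\infty)$, $\Gamma_\alpha$ is the set of probability measures $\mu$ on $\mathbb{N}$ for which there is a slowly varying $L:(0,\infty)\to(0,\infty)$ with $\mu\{n,n+1,\ldots\}=n^{-\alpha}L(n)$ for all $n\in\mathbb{N}$. $G_\mu$ is the random directed graph with vertex set $\mathbb{Z}$ in which each $z\in\mathbb{Z}$ has a unique outgoing edge, pointing to $z-k_z$, where $(k_z)_{z\in\mathbb{Z}}$ are independent with law $\mu$. Components of $G_\mu$ are those of the underlying undirected graph. *)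

(* Defs.v *)
From HB Require Import structures.
From Stdlib Require Import Relation_Operators.
From mathcomp Require Import all_boot all_order all_algebra finmap.
From mathcomp Require Import all_classical all_reals all_analysis.

Set Implicit Arguments.
Unset Strict Implicit.
Unset Printing Implicit Defensive.

Import Order.TTheory GRing.Theory Num.Theory.
Import numFieldNormedType.Exports.

Local Open Scope classical_set_scope.
Local Open Scope ring_scope.

(* The positive integers {1, 2, ...} are rendered inside nat: a probability
   measure on them is a [probability nat R] that gives no mass to 0. *)

(* Only the restriction of L to (0, oo) matters. *)
Definition slowly_varying (R : realType) (L : R -> R) : Prop :=
  (forall u, 0 < u -> 0 < L u) /\
  (forall r, 0 < r -> L (u * (1 + r)) / L u @[u --> +oo] --> (1 : R)).

Definition Gamma (R : realType) (alpha : R) (mu : probability nat R) : Prop :=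
  mu [set 0%N] = 0%E /\
  exists L : R -> R, slowly_varying L /\
    forall n : nat, (0 < n)%N ->
      mu [set m | (n <= m)%N] = (n%:R `^ (- alpha) * L n%:R)%:E.

Definition law_support (R : realType) (mu : probability nat R) : set nat :=
  [set n | mu [set n] != 0%E].

Definition is_gcd (S : set nat) (g : nat) : Prop :=
  (forall n, S n -> (g %| n)%N) /\
  (forall e, (forall n, S n -> (e %| n)%N) -> (e %| g)%N).

Definition mutually_independent (d d' : measure_display) (R : realType)
    (Omega : measurableType d) (P : probability Omega R)
    (E : measurableType d') (I : choiceType) (X : I -> {RV P >-> E}) : Prop :=
  forall (J : {fset I}) (A : I -> set E),
    (forall i, i \in J -> measurable (A i)) ->
    P (\bigcap_(i in [set` J]) (X i @^-1` A i)) =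
    (\prod_(i <- J) P (X i @^-1` A i))%E.

Definition jump_graph (k : int -> nat) (x y : int) : Prop :=
  y = x - (k x)%:Z.

Definition underlying (V : Type) (E : V -> V -> Prop) (x y : V) : Prop :=
  E x y \/ E y x.

(* Reachability by a finite path in the underlying undirected graph. *)
Definition component (V : Type) (E : V -> V -> Prop) (x : V) : set V :=
  [set y | clos_refl_trans V (underlying E) x y].

Definition components (V : Type) (E : V -> V -> Prop) : set (set V) :=
  range (component E).

(* Main.v *)
Require Import Defs.
From Stdlib Require Import Relation_Operators.
From mathcomp Require Import all_boot all_order all_algebra finmap.
From mathcomp Require Import all_classical all_reals all_analysis.
From mathcomp Require Import ring lra zify.

(** Two vertices of the graph lie in the same component exactly when their
ancestral lines [z], [z - k_z], ... have a common point.  As long as the two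
lines have not met they use jumps attached to different vertices, so they
behave like two independent renewal processes with increment law [mu] running
downwards.  Write [q n] for the probability that a renewal process started
from [0] visits [n] ([renewal]); the expected number of common points of two
such processes started together is the sum of the [q n ^ 2], and the theorem
amounts to deciding whether this series converges.

All probabilities are computed by finite sums.  For a base point [z], let
[meet_prob a b] be the probability that the lines started at [z + a] and
[z + b] meet at a vertex that is at least [z]; always moving the higher of the
two lines gives a finite recursion in [a + b].  The lemma [P_meet_event]
identifies [meet_prob] with the probability of the corresponding event of the
graph, and one lets [z] tend to minus infinity.  About the tail
[T n = mu {n, n+1, ...}] only one consequence of regular variation is used:
[T (2 n) / T n] tends to [2 ^ (- alpha)] ([tail_mass_ratio]).

If [alpha > 1/2], the renewal equation [sum_(i <= n) q i * T (n + 1 - i) = 1]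
and the Cauchy-Schwarz inequality show that the series of the [q n ^ 2]
diverges ([sum_renewal_sqr_unbounded]).  If two lines at a distance [k] in the
support of [mu] avoided each other for ever with positive probability, two
lines that coincide would have at each coincidence a fixed chance of never
coinciding again, and the expected number of coincidences would be finite
([common_renewals_le_meet_prob]).  Hence lines at such a distance meet almost
surely, and a subgroup argument that uses the gcd hypothesis extends this to
all distances ([sure_meetT]).

If [alpha < 1/2], the series converges ([renewal_sqr_summable]).  One cuts the
increments at [M] and solves the renewal equation on the cyclic group of order
[N = 2 ^ j] by Fourier inversion.  The solution dominates [q] up to [M]
([renewal_le_green]), and by Parseval the sum of its squares is at most the
mean over the frequencies [l] of [1 / A l ^ 2], where [A l] is the real part
of one minus the characteristic function ([sum_renewal_sqr_le]).  For [l] of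
order [2 ^ i] the increments of order [N / l] turn by an angle with negative
cosine, so that [A l] is at least of order [T (2 ^ (j - i))]; at frequencies
comparable to [N] this fails and the gcd hypothesis provides a lower bound
instead ([char_re_dyadic]).  Since the tail loses a factor larger than
[1 / sqrt 2] per doubling, the mean stays bounded.  Consequently [meet_prob]
tends to [0] with the distance ([meet_prob_small]), and [r] vertices placed
far enough from one another lie in [r] different components with probability
as close to [1] as desired ([ae_distinct_components]). *)

Set Implicit Arguments.
Unset Strict Implicit.
Unset Printing Implicit Defensive.

Import Order.TTheory GRing.Theory Num.Theory.
Import numFieldNormedType.Exports.

Local Open Scope classical_set_scope.
Local Open Scope ring_scope.

(** * Recursion along a measure *)
Section StrongRecursion.
Variables (A T : Type) (t0 : T) (m : A -> nat) (Phi : (A -> T) -> A -> T).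

Definition strong_rec (a : A) : T := iter (m a).+1 Phi (fun=> t0) a.

Hypothesis Phi_local : forall u v a,
  (forall b, (m b < m a)%N -> u b = v b) -> Phi u a = Phi v a.

(** Since [Phi u a] depends on [u] only where [m] is smaller than at [a], more
than [m a] iterations of [Phi] settle the value at [a], whatever the starting
function. *)
Lemma strong_recE a : strong_rec a = Phi strong_rec a.
Proof.
have stable s n1 n2 b : (m b < s)%N -> (m b < n1)%N -> (m b < n2)%N ->
    iter n1 Phi (fun=> t0) b = iter n2 Phi (fun=> t0) b.
  elim: s n1 n2 b => // s IHs [|n1] [|n2] // b bs bn1 bn2.
  by apply: Phi_local => c cb; apply: IHs; lia.
apply: Phi_local => b ba.
by apply: (stable (m b).+1); lia.
Qed.

End StrongRecursion.

(** * Renewal sequences and meeting probabilities *)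
Section Renewal.
Variables (R : realFieldType) (p : nat -> R).

(** For a law [p] on the positive integers this is the mass of [n, n + 1, ...],
as a finite expression. *)
Definition tail (n : nat) : R := 1 - \sum_(1 <= k < n) p k.

Definition renewal_step (u : nat -> R) (n : nat) : R :=
  (n == 0%N)%:R + \sum_(i < n) p (n - i) * u i.

(** The probability that the renewal process with increment law [p] visits
[n], by conditioning on the last visit before [n]. *)
Definition renewal : nat -> R := strong_rec 0 id renewal_step.

(** The higher line jumps from [x.1] to [i] with probability [p (x.1 - i)]; the
mass of the jumps below [0] is lost. *)
Definition meet_step (u : nat * nat -> R) (x : nat * nat) : R :=
  if x.1 == x.2 then 1
  else if (x.2 < x.1)%N then \sum_(i < x.1) p (x.1 - i) * u (nat_of_ord i, x.2)
  else \sum_(i < x.2) p (x.2 - i) * u (x.1, nat_of_ord i).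

Definition meet_prob (a b : nat) : R :=
  strong_rec 0 (fun x : nat * nat => (x.1 + x.2)%N) meet_step (a, b).

Lemma renewalE n :
  renewal n = (n == 0%N)%:R + \sum_(i < n) p (n - i) * renewal i.
Proof.
rewrite /renewal strong_recE // => u v a uv.
by congr (_ + _); apply: eq_bigr => i _; rewrite uv.
Qed.

Lemma renewal0 : renewal 0 = 1.
Proof. by rewrite renewalE big_ord0 addr0. Qed.

Lemma meet_probE a b : meet_prob a b =
  if a == b then 1
  else if (b < a)%N then \sum_(i < a) p (a - i) * meet_prob i b
  else \sum_(i < b) p (b - i) * meet_prob a i.
Proof.
rewrite {1}/meet_prob strong_recE // => u v [x y] uv; rewrite /meet_step /=.
case: eqP => // /eqP neq_xy; case: ltnP => xy.
- by apply: eq_bigr => i _; rewrite uv //= ltn_add2r.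
- by apply: eq_bigr => i _; rewrite uv //= ltn_add2l.
Qed.

Lemma meet_prob_diag a : meet_prob a a = 1.
Proof. by rewrite meet_probE eqxx. Qed.

Lemma meet_prob_gt a b : (b < a)%N ->
  meet_prob a b = \sum_(i < a) p (a - i) * meet_prob i b.
Proof. by move=> ba; rewrite meet_probE ba; case: eqP ba => // ->; rewrite ltnn. Qed.

Lemma meet_probC a b : meet_prob a b = meet_prob b a.
Proof.
have [n] := ubnP (a + b); elim: n a b => // n IHn a b abn.
rewrite meet_probE [RHS]meet_probE eq_sym; case: eqP => // /eqP ab.
by have [ba|ba|/eqP] := ltngtP a b; last (by rewrite eq_sym (negPf ab));
  apply: eq_bigr => i _; rewrite IHn //; have := ltn_ord i; lia.
Qed.

(** Induction over pairs, reduced by symmetry to those with [b <= a]. *)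
Lemma meet_ind (Q : nat -> nat -> Prop) :
  (forall a b, Q a b -> Q b a) -> (forall a, (forall i, (i < a)%N -> Q i a) -> Q a a) ->
  (forall a b, (b < a)%N -> (forall i, (i < a)%N -> Q i b) -> Q a b) ->
  forall a b, Q a b.
Proof.
move=> QC Qaa Qlt a b.
have [n] := ubnP (a + b); elim: n a b => // n IHn a b abn.
have [ba|ab|ba] := ltngtP b a; last subst b.
- by apply: Qlt => // i ia; apply: IHn; lia.
- by apply: QC; apply: Qlt => // i ia; apply: IHn; lia.
- by apply: Qaa => i ia; apply: IHn; lia.
Qed.

Hypothesis p_ge0 : forall k, 0 <= p k.

Lemma renewal_ge0 n : 0 <= renewal n.
Proof.
elim/ltn_ind: n => n IHn; rewrite renewalE addr_ge0 ?sumr_ge0 // => i _.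
by rewrite mulr_ge0 ?IHn.
Qed.

Lemma meet_prob_ge0 a b : 0 <= meet_prob a b.
Proof.
move: a b; apply: meet_ind => [a b|a _|a b ba IH]; first by rewrite meet_probC.
- by rewrite meet_prob_diag.
- by rewrite meet_prob_gt // sumr_ge0 // => i _; rewrite mulr_ge0 ?IH.
Qed.

Lemma sum_pE n : \sum_(i < n) p (n - i) = \sum_(1 <= k < n.+1) p k.
Proof.
rewrite big_add1 /= big_mkord (reindex_inj rev_ord_inj) /=.
by apply: eq_bigr => i _; congr p; have := ltn_ord i; lia.
Qed.

Lemma tailS n : (0 < n)%N -> tail n.+1 = tail n - p n.
Proof. by move=> n0; rewrite /tail big_nat_recr //= opprD addrA. Qed.

Lemma tail1 : tail 1 = 1.
Proof. by rewrite /tail big_geq // subr0. Qed.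

Lemma le_tail m n : (m <= n)%N -> tail n <= tail m.
Proof.
move=> /subnKC <-; elim: (n - m)%N => [|k IHk]; first by rewrite addn0.
rewrite addnS (le_trans _ IHk) //.
have [->|mk] := posnP (m + k)%N; first by rewrite /tail !big_geq.
by rewrite tailS // lerBlDr lerDl.
Qed.

Hypothesis sum_p_le1 : forall n, \sum_(1 <= k < n) p k <= 1.

Lemma meet_prob_le1 a b : meet_prob a b <= 1.
Proof.
move: a b; apply: meet_ind => [a b|a _|a b ba IH]; first by rewrite meet_probC.
- by rewrite meet_prob_diag.
- rewrite meet_prob_gt // (le_trans _ (sum_p_le1 a.+1)) // -sum_pE ler_sum // => i _.
  by rewrite ler_piMr ?IH.
Qed.

(** Shifting both lines up by one adds the possibility of meeting at [0]. *)
Lemma meet_prob_succ a b : meet_prob a b <= meet_prob a.+1 b.+1.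
Proof.
move: a b; apply: meet_ind => [a b|a _|a b ba IH].
- by rewrite meet_probC [meet_prob b.+1 _]meet_probC.
- by rewrite !meet_prob_diag.
- rewrite !meet_prob_gt // big_ord_recl /= addrC ler_wpDr //.
    by rewrite mulr_ge0 ?meet_prob_ge0.
  by apply: ler_sum => i _; rewrite /bump /= add1n subSS ler_wpM2l ?IH.
Qed.

Lemma meet_prob_shift c a b : meet_prob a b <= meet_prob (a + c) (b + c).
Proof.
elim: c => [|c IHc]; first by rewrite !addn0.
by rewrite !addnS (le_trans IHc) ?meet_prob_succ.
Qed.

(** * Common points of two independent lines *)

(** The probability that the line started at [a] visits [c]. *)
Definition renewal_from (a c : nat) : R :=
  if (c <= a)%N then renewal (a - c) else 0.

Lemma renewal_fromE a c : renewal_from a c =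
  (a == c)%:R + \sum_(i < a) p (a - i) * renewal_from i c.
Proof.
rewrite /renewal_from; case: leqP => [ca|ac]; last first.
  rewrite ltn_eqF // big1 ?addr0 // => i _.
  by rewrite leqNgt (ltn_trans (ltn_ord i) ac) mulr0.
rewrite renewalE subn_eq0 [in RHS]eqn_leq ca andbT; congr (_ + _).
rewrite -(big_mkord xpredT (fun i => p (a - c - i)%N * renewal i)).
rewrite -(big_mkord xpredT (fun i => p (a - i)%N * if (c <= i)%N then renewal (i - c) else 0)).
rewrite [RHS](@big_cat_nat _ _ _ c) //= [X in _ = X + _]big1_seq ?add0r; last first.
  by move=> i; rewrite mem_index_iota => /and3P[_ _ ic]; rewrite leqNgt ic mulr0.
rewrite [X in _ = X](_ : _ = \sum_(0 + c <= i < a) p (a - i) * if (c <= i)%N then renewal (i - c) else 0) // big_addn.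
apply: eq_bigr => i _.
by rewrite leq_addl addnK; congr (p _ * _); lia.
Qed.

(** Expected number of common points below [N] of two lines that use
independent increments even after they have met. *)
Definition common_renewals (N a b : nat) : R :=
  \sum_(c < N) renewal_from a c * renewal_from b c.

Lemma common_renewals_ge0 N a b : 0 <= common_renewals N a b.
Proof.
apply: sumr_ge0 => c _; rewrite /renewal_from.
by do 2!case: ifP => _; rewrite ?mulr0 ?mul0r // mulr_ge0 ?renewal_ge0.
Qed.

Lemma common_renewalsC N a b : common_renewals N a b = common_renewals N b a.
Proof. by apply: eq_bigr => c _; rewrite mulrC. Qed.

(** Condition on the first jump of the line started at [a]; the indicator
counts a common point at [a] itself. *)
Lemma common_renewals_step N a b : (b <= a)%N -> common_renewals N a b =
  ((a == b) && (a < N)%N)%:R + \sum_(i < a) p (a - i) * common_renewals N i b.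
Proof.
move=> ba; rewrite /common_renewals.
under eq_bigr => c _ do rewrite renewal_fromE mulrDl mulr_suml.
rewrite big_split /=; congr (_ + _); last first.
  rewrite exchange_big /=; apply: eq_bigr => i _; rewrite mulr_sumr.
  by apply: eq_bigr => c _; rewrite mulrA.
have [aN|Na] := ltnP a N; last first.
  by rewrite andbF big1 // => c _; rewrite gtn_eqF ?mul0r // (leq_trans _ Na).
rewrite (bigD1 (Ordinal aN)) //= eqxx mul1r big1 ?addr0 => [|c]; last first.
  by rewrite -val_eqE eq_sym /= => /negPf ->; rewrite mul0r.
rewrite andbT /renewal_from; case: eqP => [->|/eqP nab].
  by rewrite leqnn subnn renewal0.
by rewrite leqNgt ltn_neqAle eq_sym nab ba.
Qed.

Lemma common_renewals_diag N :
  common_renewals N.+1 N N = \sum_(n < N.+1) renewal n ^+ 2.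
Proof.
rewrite /common_renewals (reindex_inj rev_ord_inj) /=.
apply: eq_bigr => i _; rewrite /renewal_from subSS leq_subr expr2.
by rewrite subKn // -ltnS.
Qed.

Lemma meet_prob_le_common_renewals N a b : (a < N)%N -> (b < N)%N ->
  meet_prob a b <= common_renewals N a b.
Proof.
move: a b; apply: meet_ind => [a b IH bN aN|a _ aN _|a b ba IH aN bN].
- by rewrite meet_probC common_renewalsC IH.
- rewrite meet_prob_diag common_renewals_step // eqxx aN ler_wpDr // sumr_ge0 // => i _.
  by rewrite mulr_ge0 ?common_renewals_ge0.
- rewrite meet_prob_gt // (common_renewals_step _ (ltnW ba)) gtn_eqF //= add0r.
  by apply: ler_sum => i _; rewrite ler_wpM2l ?IH // (ltn_trans _ aN).
Qed.

(** * The renewal equation *)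

(** The left-hand side is the probability of the sure event that some visit,
the last one up to [n], is followed by an increment leading beyond [n]. *)
Lemma renewal_tail n : \sum_(i < n.+1) renewal i * tail (n.+1 - i) = 1.
Proof.
elim: n => [|n IHn]; first by rewrite big_ord1 subn0 renewal0 tail1 mulr1.
rewrite big_ord_recr /= subSnn tail1 mulr1 renewalE add0r -big_split /= -[RHS]IHn.
apply: eq_bigr => i _; have i_n : (i <= n)%N by rewrite -ltnS.
by rewrite subSn 1?leqW // tailS ?subn_gt0 //; ring.
Qed.

Lemma tail_ge0 n : 0 <= tail n.
Proof. by rewrite subr_ge0 sum_p_le1. Qed.

(** Sum the renewal equation over [n < N] and enlarge the triangle of pairs
[i <= n] to a square. *)
Lemma sum_renewal_tail N :
  N%:R <= (\sum_(i < N) renewal i) * \sum_(j < N) tail j.+1.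
Proof.
have -> : N%:R = \sum_(n < N) \sum_(i < N | (i <= n)%N) renewal i * tail (n.+1 - i).
  rewrite -[N in LHS]card_ord -sum1_card natr_sum; apply: eq_bigr => n _.
  rewrite -(renewal_tail n) -(big_mkord xpredT (fun i => renewal i * tail (n.+1 - i))).
  rewrite (big_nat_widen _ _ N) ?ltn_ord // big_mkord.
  by apply: eq_bigl => i; rewrite ltnS.
rewrite (exchange_big_dep xpredT) //= mulr_suml; apply: ler_sum => i _.
rewrite -mulr_sumr ler_wpM2l ?renewal_ge0 //.
rewrite [leLHS](eq_bigr (fun n : 'I_N => tail (n - i).+1)) => [|n iN]; last by rewrite subSn.
rewrite -(big_mkord (fun n => i <= n)%N (fun n => tail (n - i).+1)).
rewrite -(big_mkord xpredT (fun n => tail n.+1)).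
rewrite (@big_cat_nat _ _ _ i) //= ?(ltnW (ltn_ord i)) // [X in X + _]big1_seq ?add0r; last first.
  by move=> n; rewrite mem_index_iota; lia.
rewrite -{1}[nat_of_ord i]add0n big_addn.
rewrite (eq_big xpredT (fun n => tail n.+1)) => [|n|n _]; last 2 first.
- by rewrite leq_addl.
- by rewrite addnK.
rewrite [leRHS](@big_cat_nat _ _ _ (N - i)) ?leq_subr //= lerDl.
by apply: sumr_ge0 => j _; apply: tail_ge0.
Qed.

Lemma sqr_sum_le N (u : nat -> R) :
  (\sum_(i < N) u i) ^+ 2 <= N%:R * \sum_(i < N) u i ^+ 2.
Proof.
have -> : N%:R * \sum_(i < N) u i ^+ 2 =
    2^-1 * \sum_(i < N) \sum_(j < N) (u i ^+ 2 + u j ^+ 2).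
  under [in RHS]eq_bigr => i _ do rewrite big_split /= sumr_const card_ord.
  by rewrite [in RHS]big_split /= sumr_const card_ord sumrMnl -mulr_natl; field.
rewrite expr2 big_distrlr /= mulr_sumr; apply: ler_sum => i _.
rewrite mulr_sumr; apply: ler_sum => j _.
by have := sqr_ge0 (u i - u j); rewrite sqrrB; lra.
Qed.

Lemma sum_renewal_sqr N : N%:R <=
  (\sum_(n < N) renewal n ^+ 2) * (\sum_(j < N) tail j.+1) ^+ 2.
Proof.
case: N => [|N]; first by rewrite !big_ord0 mul0r.
rewrite -(@ler_pM2l _ N.+1%:R) // mulrA.
have h := sqr_sum_le N.+1 renewal.
apply: le_trans (ler_wpM2r (sqr_ge0 _) h).
by rewrite -exprMn -expr2 lerXn2r ?nnegrE ?sum_renewal_tail // mulr_ge0 // sumr_ge0 // => i _;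
  rewrite ?renewal_ge0 ?tail_ge0.
Qed.
End Renewal.

(** * Recurrence *)
(** Let [g] be the least positive element of [S].  The remainder modulo [g] of
an element of [K] is again in [S], hence is [0]; so [g] divides all of [K]. *)
Lemma gcd1_subgroup (K : nat -> Prop) (S : int -> Prop) :
  (forall e, (forall n, K n -> (e %| n)%N) -> (e %| 1)%N) ->
  (forall x y, S x -> S y -> S (x - y)) -> (forall n, K n -> S n%:Z) ->
  forall x, S x.
Proof.
move=> K_gcd SB SK.
have [k0 Kk0 k0_gt0] : exists2 k, K k & (0 < k)%N.
  apply: contrapT => noK; have: (0 %| 1)%N by apply: K_gcd => -[|n] Kn //; case: noK; exists n.+1.
  by rewrite dvd0n.
have S0 : S 0 by rewrite -(subrr k0%:Z); apply: SB; apply: SK.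
have SM x n : S x -> S (x * n%:Z).
  move=> Sx; elim: n => [|n IHn]; first by rewrite mulr0.
  rewrite (_ : x * n.+1%:Z = x * n%:Z - (0 - x)); last by rewrite -addn1 PoszD; ring.
  by apply/SB => //; apply: SB.
have ex_pos : exists n : nat, `[< (0 < n)%N /\ S n%:Z >].
  by exists k0; apply/asboolP; split => //; apply: SK.
case: (ex_minnP ex_pos) => g /asboolP[g_gt0 Sg] g_min.
have g1 : (g %| 1)%N.
  apply: K_gcd => n Kn; rewrite /dvdn -leqn0 leqNgt; apply/negP => r_gt0.
  suff /g_min : `[< (0 < n %% g)%N /\ S (n %% g)%N%:Z >] by have := ltn_pmod n g_gt0; lia.
  apply/asboolP; split => //.
  rewrite (_ : (n %% g)%N%:Z = n%:Z - g%:Z * (n %/ g)%N%:Z); first by apply: SB; [apply: SK | apply: SM].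
  by rewrite {2}(divn_eq n g) PoszD PoszM; ring.
move: Sg; rewrite (eqP (_ : g == 1%N)) -?dvdn1 // => S1.
case=> n; first by rewrite -[Posz n]mul1r; apply: SM.
by rewrite NegzE -sub0r -[Posz n.+1]mul1r; apply: SB => //; apply: SM.
Qed.

Section Recurrence.
Variables (R : archiRealFieldType) (p : nat -> R).
Hypothesis p_ge0 : forall k, 0 <= p k.
Hypothesis sum_p_le1 : forall n, \sum_(1 <= k < n) p k <= 1.

Lemma expr_unbounded (x B : R) : 1 < x -> exists j, B < x ^+ j.
Proof.
move=> x1; have -> : x = 1 + (x - 1) by ring.
move: (x - 1) (subr_gt0 1 x) => y; rewrite x1 => y0.
have bern j : 1 + j%:R * y <= (1 + y) ^+ j.
  elim: j => [|j IHj]; first by rewrite mul0r addr0.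
  rewrite exprS -natr1; have j0 : 0 <= j%:R :> R by [].
  have : (1 + y) * (1 + j%:R * y) <= (1 + y) * (1 + y) ^+ j by rewrite ler_pM2l //; lra.
  by nra.
exists (Num.bound (`|B| / y)); apply: lt_le_trans (bern _).
have := archi_boundP (divr_ge0 (normr_ge0 B) (ltW y0)).
rewrite ltr_pdivrMr // => h; apply: le_lt_trans (ler_norm B) _; lra.
Qed.

(** Below the scale [2 ^ n0], where nothing is known about the decay, the bound
[tail <= 1] is compensated by the constant [rho ^- n0]. *)
Lemma tail_pow2_le (rho : R) (n0 : nat) : 0 < rho -> rho < 1 ->
  (forall n, (n0 <= n)%N -> tail p (2 * n) <= rho * tail p n) ->
  exists2 C, 0 < C & forall j, tail p (2 ^ j) <= C * rho ^+ j.
Proof.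
move=> rho0 rho1 decay; exists (rho ^- n0); first by rewrite invr_gt0 exprn_gt0.
elim=> [|j IHj].
  rewrite expr0 mulr1 (@le_trans _ _ 1) ?tail1 //.
  by rewrite invf_ge1 ?exprn_gt0 // exprn_ile1 // ltW.
have [jn0|n0j] := ltnP j n0.
  rewrite (@le_trans _ _ 1) //.
    by rewrite /tail gerBl sumr_ge0.
  by rewrite ler_pdivlMl ?exprn_gt0 // mulr1 ler_wiXn2l // ltW.
rewrite expnS (le_trans (decay _ _)) //.
  by rewrite (leq_trans n0j) // ltnW // ltn_expl.
by rewrite exprS mulrCA ler_wpM2l // ltW.
Qed.

(** The dyadic block of [2 ^ j] terms contributes at most a multiple of
[(2 * rho) ^+ j], a geometric growth because [rho > 1 / 2]. *)
Lemma sum_tail_pow2_le (rho : R) (n0 : nat) : 2^-1 < rho -> rho < 1 ->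
  (forall n, (n0 <= n)%N -> tail p (2 * n) <= rho * tail p n) ->
  exists2 D, 0 < D & forall j, \sum_(i < 2 ^ j) tail p i.+1 <= D * (2 * rho) ^+ j.
Proof.
move=> rho2 rho1 decay; have rho0 : 0 < rho by lra.
have [C C0 tailC] := tail_pow2_le rho0 rho1 decay.
have r1 : 0 < 2 * rho - 1 by lra.
pose D := 1 + C / (2 * rho - 1); exists D.
  by rewrite addr_gt0 // divr_gt0.
elim=> [|j IHj]; first by rewrite big_ord1 tail1 expr0 mulr1 lerDl divr_ge0 // ltW.
rewrite expnS mul2n -addnn big_split_ord /= exprS.
have blk : \sum_(i < 2 ^ j) tail p (2 ^ j + i).+1 <= C * (2 * rho) ^+ j.
  apply: (@le_trans _ _ (\sum_(i < 2 ^ j) C * rho ^+ j)).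
    apply: ler_sum => i _; apply: le_trans (tailC j).
    by apply: le_tail => //; lia.
  by rewrite sumr_const card_ord -[leLHS]mulr_natr natrX exprMn; lra.
have pw : 0 < (2 * rho) ^+ j by rewrite exprn_gt0 // mulr_gt0.
have eD : D * (2 * rho - 1) = 2 * rho - 1 + C by rewrite /D; field; lra.
have : D * (2 * rho) ^+ j + C * (2 * rho) ^+ j <= D * (2 * rho * (2 * rho) ^+ j).
  rewrite -subr_ge0 (_ : _ - _ = (D * (2 * rho - 1) - C) * (2 * rho) ^+ j); last ring.
  by rewrite eD mulr_ge0 ?(ltW pw) //; lra.
move=> h; apply: le_trans h; exact: lerD.
Qed.

(** By [sum_renewal_sqr] the partial sum up to [2 ^ j] is at least
[2 ^ j / (D * (2 * rho) ^+ j) ^+ 2], which is a multiple of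
[(2 * rho ^+ 2)^-1 ^+ j]. *)
Lemma sum_renewal_sqr_unbounded (rho : R) (n0 : nat) (B : R) :
  2^-1 < rho -> 2 * rho ^+ 2 < 1 ->
  (forall n, (n0 <= n)%N -> tail p (2 * n) <= rho * tail p n) ->
  exists N, B < \sum_(n < N) renewal p n ^+ 2.
Proof.
move=> rho2 rho_lt decay; have rho1 : rho < 1 by nra.
have [D D0 sumD] := sum_tail_pow2_le rho2 rho1 decay.
have rho0 : 0 < 2 * rho ^+ 2 by rewrite mulr_gt0 // exprn_gt0 //; lra.
have [j Bj] : exists j, `|B| * D ^+ 2 < (2 * rho ^+ 2)^-1 ^+ j.
  by apply: expr_unbounded; rewrite invf_gt1.
exists (2 ^ j)%N; apply: le_lt_trans (ler_norm B) _.
set S := \sum_(n < _) _.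
have S0 : 0 <= S by apply: sumr_ge0 => i _; apply: sqr_ge0.
have /le_trans le2 := sum_renewal_sqr p_ge0 sum_p_le1 (2 ^ j).
have {le2} : (2 ^ j)%:R <= S * (D * (2 * rho) ^+ j) ^+ 2.
  apply: le2; rewrite ler_wpM2l // lerXn2r ?nnegrE //.
    by apply: sumr_ge0 => i _; apply: tail_ge0.
  by rewrite mulr_ge0 ?exprn_ge0 //; lra.
have -> : (D * (2 * rho) ^+ j) ^+ 2 = D ^+ 2 * (2 ^+ j * (2 * rho ^+ 2) ^+ j).
  by rewrite -exprMn [LHS]exprMn -exprM mulnC exprM; congr (_ * _ ^+ _); ring.
set r := 2 * rho ^+ 2 in rho0 Bj *.
have -> : S * (D ^+ 2 * (2 ^+ j * r ^+ j)) = 2 ^+ j * (S * D ^+ 2 * r ^+ j) by ring.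
rewrite natrX -[leLHS]mulr1 ler_pM2l ?exprn_gt0 // => leS.
rewrite -(@ltr_pM2r _ (D ^+ 2)) ?exprn_gt0 //; apply: lt_le_trans Bj _.
rewrite exprVn -div1r ler_pdivrMr ?exprn_gt0 //; lra.
Qed.

Lemma sum_p_le (f : nat -> R) (a i0 : nat) : (i0 < a)%N ->
  (forall i, 0 <= f i) -> (forall i, f i <= 1) ->
  \sum_(i < a) p (a - i) * f i <= 1 - p (a - i0) * (1 - f i0).
Proof.
move=> i0a f0 f1; rewrite lerBrDr (le_trans _ (sum_p_le1 a.+1)) // -sum_pE.
rewrite (bigD1 (Ordinal i0a)) // [leRHS](bigD1 (Ordinal i0a)) //=.
have -> (x y z : R) : x * y + z + x * (1 - y) = x + z by ring.
by rewrite lerD2l; apply: ler_sum => i _; rewrite ler_piMr.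
Qed.

(** Whenever the lines coincide, with probability at least [p k0 * eps] the
first of them jumps by [k0] and then they never coincide again.  So, once they
have met, the number of their common points is dominated by a geometric
variable of mean [(p k0 * eps)^-1]. *)
Lemma common_renewals_le_meet_prob (k0 : nat) (eps : R) (N a b : nat) :
  (0 < k0)%N -> 0 <= eps <= 1 -> (forall c, meet_prob p (k0 + c) c <= 1 - eps) ->
  p k0 * eps * common_renewals p N a b <= meet_prob p a b.
Proof.
move=> k0_gt0 /andP[eps0 eps1] avoid.
have pk : p k0 <= 1.
  apply: le_trans (sum_p_le1 k0.+1); rewrite big_nat_recr //= ler_wpDl //.
  exact: sumr_ge0.
have e0 : 0 <= p k0 * eps by rewrite mulr_ge0.
move: a b; apply: meet_ind => [a b|a IH|a b ba IH].
- by rewrite meet_probC common_renewalsC.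
- rewrite meet_prob_diag common_renewals_step // eqxx /= mulrDr mulr_sumr.
  have le_e : p k0 * eps * (a < N)%:R <= p k0 * eps by rewrite ler_piMr // lern1 leq_b1.
  have le_s : \sum_(i < a) p k0 * eps * (p (a - i) * common_renewals p N i a) <=
      \sum_(i < a) p (a - i) * meet_prob p i a.
    by apply: ler_sum => i _; rewrite mulrCA ler_wpM2l ?IH.
  suff : \sum_(i < a) p (a - i) * meet_prob p i a <= 1 - p k0 * eps by lra.
  have [ak0|k0a] := ltnP a k0.
    apply: (@le_trans _ _ (1 - p k0)); last by have := p_ge0 k0; nra.
    rewrite lerBrDr (le_trans _ (sum_p_le1 k0.+1)) // big_nat_recr //= lerD2r.
    apply: (@le_trans _ _ (\sum_(i < a) p (a - i))).
      by apply: ler_sum => i _; rewrite ler_piMr // meet_prob_le1.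
    rewrite sum_pE [leRHS](@big_cat_nat _ _ _ a.+1) //= lerDl; exact: sumr_ge0.
  have lt_a : (a - k0 < a)%N by lia.
  apply: le_trans (sum_p_le (f := fun i => meet_prob p i a) lt_a
    (fun i => meet_prob_ge0 p_ge0 i a) (fun i => meet_prob_le1 p_ge0 sum_p_le1 i a)) _.
  have := avoid (a - k0)%N; rewrite subnKC // meet_probC subKn // => h.
  by rewrite lerD2l lerN2 ler_wpM2l //; lra.
- rewrite meet_prob_gt // (common_renewals_step _ _ (ltnW ba)) gtn_eqF // add0r mulr_sumr.
  by apply: ler_sum => i _; rewrite mulrCA ler_wpM2l ?IH.
Qed.

(** Lowering the base by [c] is the same as raising both lines by [c]: lines
related in this way meet with probability one when no base is imposed. *)
Definition sure_meet (a b : nat) : Prop :=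
  forall eps, 0 < eps -> exists c, 1 - eps <= meet_prob p (a + c) (b + c).

Lemma sure_meet_diag a : sure_meet a a.
Proof. by move=> e e0; exists 0%N; rewrite meet_prob_diag; lra. Qed.

Lemma sure_meetC a b : sure_meet a b -> sure_meet b a.
Proof. by move=> ab e /ab[c]; rewrite meet_probC; exists c. Qed.

Lemma sure_meet_shift c a b : sure_meet (a + c) (b + c) <-> sure_meet a b.
Proof.
split=> ab e /ab[c' h]; first by exists (c + c')%N; rewrite !addnA.
exists c'; apply: le_trans h _; rewrite addnAC [(b + c + _)%N]addnAC.
exact: meet_prob_shift.
Qed.

(** If the meeting probability after the jump [k] stayed away from [1], so
would the one before it, because [k] has positive mass. *)
Lemma sure_meet_step a b k : (b < a)%N -> (0 < k <= a)%N -> 0 < p k ->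
  sure_meet a b -> sure_meet (a - k) b.
Proof.
move=> ba /andP[k0 ka] pk ab e e0.
have [|c] := ab (p k * e); first exact: mulr_gt0.
rewrite meet_prob_gt ?ltn_add2r // => h; exists c.
have lt_a : (a - k + c < a + c)%N by lia.
have := sum_p_le (f := fun i => meet_prob p i (b + c)) lt_a
  (fun i => meet_prob_ge0 p_ge0 _ _) (fun i => meet_prob_le1 p_ge0 sum_p_le1 _ _).
have -> : (a + c - (a - k + c) = k)%N by lia.
move=> h'.
have : p k * (1 - meet_prob p (a - k + c) (b + c)) <= p k * e by lra.
by rewrite ler_pM2l //; lra.
Qed.

(** A tail that stayed constant from some point on could not halve its argument
at the cost of a factor [rho < 1]. *)
Lemma support_unbounded (rho : R) (n0 : nat) : rho < 1 -> (forall n, 0 < tail p n) ->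
  (forall n, (n0 <= n)%N -> tail p (2 * n) <= rho * tail p n) ->
  forall n, exists2 k, (n <= k)%N & 0 < p k.
Proof.
move=> rho1 tail_gt0 decay n; apply: contrapT => no_k.
have p_eq0 k : (n < k)%N -> p k = 0.
  move=> /ltnW nk; apply/eqP; rewrite eq_le p_ge0 andbT leNgt.
  by apply/negP => pk; apply: no_k; exists k.
have tail_cst m i : (n < m)%N -> tail p (m + i) = tail p m.
  move=> nm; elim: i => [|i IHi]; first by rewrite addn0.
  by rewrite addnS tailS ?p_eq0 ?subr0 // ltn_addr // (leq_trans _ nm).
have n0_le : (n0 <= (n + n0).+1)%N by rewrite leqW ?leq_addl.
have := decay _ n0_le; rewrite mul2n -addnn tail_cst; last by rewrite ltnS leq_addr.
by rewrite leNgt gtr_pMl // rho1.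
Qed.

(** The set [S] of the differences [a - b] of surely meeting lines contains
[0] and the support of [p], is symmetric, and contains [x - k] when [x] is a
nonnegative element and [k] is in the support.  It is also stable under adding
[k] to a positive [x]: go down by some [k'] in the support with
[k' >= x + k], then up by [k], then up by [k'].  Thus the translations that
preserve [S] form a subgroup containing the support, so they are all the
translations. *)
Lemma sure_meetT (rho : R) (n0 : nat) :
  2^-1 < rho -> 2 * rho ^+ 2 < 1 ->
  (forall n, (n0 <= n)%N -> tail p (2 * n) <= rho * tail p n) ->
  (forall n, exists2 k, (n <= k)%N & 0 < p k) ->
  (forall e, (forall n, (0 < n)%N /\ 0 < p n -> (e %| n)%N) -> (e %| 1)%N) ->
  forall a b, sure_meet a b.
Proof.
move=> rho2 rho_lt decay p_unb p_gcd.
pose S (x : int) := forall a b : nat, a%:Z - b%:Z = x -> sure_meet a b.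
have S_intro a b : sure_meet a b -> S (a%:Z - b%:Z).
  move=> ab a' b' e; apply/(sure_meet_shift b).
  have -> : (a' + b = a + b')%N by lia.
  by rewrite [(b' + b)%N]addnC; apply/sure_meet_shift.
have SN x : S x -> S (- x).
  by move=> Sx a b e; apply: sure_meetC; apply: Sx; lia.
have S0 : S 0 by rewrite -(subrr 0%:Z); apply: S_intro; apply: sure_meet_diag.
have Sk k : (0 < k)%N -> 0 < p k -> S k%:Z.
  move=> k0 pk; rewrite -[k%:Z]subr0 -[0]/(0%N%:Z); apply: S_intro => e e0.
  have [|e1] := leP 1 e.
    exists 0%N; rewrite (@le_trans _ _ 0) ?subr_le0 //; exact: meet_prob_ge0.
  apply: contrapT => noc; have pe : 0 < p k * e by rewrite mulr_gt0.
  have [N] := sum_renewal_sqr_unbounded (p k * e)^-1 rho2 rho_lt decay.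
  case: N => [|N]; first by rewrite big_ord0 invr_lt0 ltNge (ltW pe).
  rewrite -common_renewals_diag -div1r ltr_pdivrMr // mulrC ltNge.
  rewrite (le_trans (@common_renewals_le_meet_prob k e N.+1 N N _ _ _)) ?meet_prob_le1 //.
    by rewrite !ltW.
  move=> c; rewrite leNgt; apply/negP => /ltW h; apply: noc; exists c.
  by rewrite add0n.
have S_down x k : 0 <= x -> (0 < k)%N -> 0 < p k -> S x -> S (x - k%:Z).
  move=> x0 k0 pk Sx; have [->|x_neq0] := eqVneq x 0.
    by rewrite sub0r; apply/SN/Sk.
  have -> : x - k%:Z = (`|x| + k - k)%N%:Z - k%:Z by lia.
  apply: S_intro; apply: sure_meet_step => //; try lia.
  by apply: Sx; lia.
have S_up x k : x <= 0 -> (0 < k)%N -> 0 < p k -> S x -> S (x + k%:Z).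
  move=> x0 k0 pk Sx; rewrite -[x + _]opprK opprD; apply/SN.
  by apply: S_down => //; [lia | exact/SN].
pose T (d : int) := forall x, S x -> S (x + d).
have all_T : forall d, T d.
  apply: (gcd1_subgroup p_gcd) => [d e Td Te x Sx|k [k0 pk] x Sx].
    rewrite addrCA addrC; have /Te/SN : S (- (x + d)) by apply/SN/Td.
    by rewrite opprD opprK; congr S; lia.
  have [x0|x0] := leP x 0; first exact: S_up.
  have [k' xk' pk'] := p_unb (`|x| + k)%N.
  rewrite (_ : x + k%:Z = x - k'%:Z + k%:Z + k'%:Z); last lia.
  apply: (S_up _ k') => //; [lia | lia |]; apply: (S_up _ k) => //; first lia.
  by apply: (S_down _ k') => //; lia.
move=> a b; apply: (all_T (a%:Z - b%:Z) 0 S0); lia.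
Qed.

End Recurrence.

(** * Discrete Fourier inversion *)
Section Fourier.
Variable R : realType.

Lemma cos_2pin (n : nat) : cos (pi *+ 2 * n%:R) = 1 :> R.
Proof.
by rewrite mulr_natr -[X in cos X]add0r (periodicn (@cosD2pi R)) cos0.
Qed.

Lemma sin_2pin (n : nat) : sin (pi *+ 2 * n%:R) = 0 :> R.
Proof.
by rewrite mulr_natr -[X in sin X]add0r (periodicn (@sinD2pi R)) sin0.
Qed.

Lemma cosE_sin_half (x : R) : cos x = 1 - 2 * sin (x / 2) ^+ 2.
Proof.
have {1}-> : x = (x / 2) *+ 2 by rewrite -mulr_natr; field.
by rewrite cos_mulr2n cos2sin2 -mulr_natr; ring.
Qed.

(** The shift [x |-> x + 1] permutes the terms, so the vector formed by the two
sums is invariant under the rotation of angle [t]; a nontrivial rotation of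
the plane fixes only the origin. *)
Lemma sum_cos_sin_eq0 (N : nat) (t : R) :
  cos (t * N%:R) = 1 -> sin (t * N%:R) = 0 -> cos t != 1 ->
  \sum_(x < N) cos (t * x%:R) = 0 /\ \sum_(x < N) sin (t * x%:R) = 0.
Proof.
move=> cosN sinN cos_neq1.
set C := \sum_(x < N) cos _; set S := \sum_(x < N) sin _.
have shiftC : \sum_(x < N) cos (t * x.+1%:R) = C.
  have := @big_ord_recl R 0 +%R N (fun x : 'I_N.+1 => cos (t * x%:R)).
  rewrite big_ord_recr /= cosN mulr0 cos0 addrC => /addrI <- //.
have shiftS : \sum_(x < N) sin (t * x.+1%:R) = S.
  have := @big_ord_recl R 0 +%R N (fun x : 'I_N.+1 => sin (t * x%:R)).
  rewrite big_ord_recr /= sinN mulr0 sin0 addrC => /addrI <- //.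
have eC : C = C * cos t - S * sin t.
  rewrite -{1}shiftC !mulr_suml -sumrB; apply: eq_bigr => x _.
  by rewrite -natr1 mulrDr mulr1 cosD.
have eS : S = S * cos t + C * sin t.
  rewrite -{1}shiftS !mulr_suml -big_split; apply: eq_bigr => x _ /=.
  by rewrite -natr1 mulrDr mulr1 sinD.
have c1 : 0 < 1 - cos t by rewrite subr_gt0 lt_neqAle cos_neq1 cos_le1.
have d0 : 0 < (1 - cos t) ^+ 2 + sin t ^+ 2 by rewrite ltr_wpDr ?sqr_ge0 ?exprn_gt0.
have eC' : C * (1 - cos t) = - (S * sin t) by rewrite mulrBr mulr1 {1}eC; ring.
have eS' : S * (1 - cos t) = C * sin t by rewrite mulrBr mulr1 {1}eS; ring.
have C0 : C * ((1 - cos t) ^+ 2 + sin t ^+ 2) = 0.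
  rewrite mulrDr expr2 mulrA eC' mulNr mulrAC eS'; ring.
have S0 : S * ((1 - cos t) ^+ 2 + sin t ^+ 2) = 0.
  rewrite mulrDr expr2 mulrA eS' mulrAC eC'; ring.
by split; apply/eqP; [move/eqP: C0 | move/eqP: S0]; rewrite mulf_eq0 (gt_eqF d0) orbF.
Qed.

Variable N : nat.
Hypothesis N_gt0 : (0 < N)%N.

Definition freq : R := pi *+ 2 / N%:R.

Let N_neq0 : N%:R != 0 :> R.
Proof. by rewrite pnatr_eq0 -lt0n. Qed.

Lemma freqN (l : nat) : freq * l%:R * N%:R = pi *+ 2 * l%:R.
Proof. by rewrite /freq; field. Qed.

Lemma freqB_neq1 (l m : nat) : (m < l < N)%N -> cos (freq * (l%:R - m%:R)) != 1.
Proof.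
move=> /andP[ml lN]; rewrite cosE_sin_half subr_eq -subr_eq0 opprD addrA subrr sub0r.
rewrite oppr_eq0 mulf_neq0 // expf_neq0 //; apply: lt0r_neq0; apply: sin_gt0_pi.
have -> : freq * (l%:R - m%:R) / 2 = pi * ((l - m)%:R / N%:R).
  by rewrite natrB 1?ltnW // /freq -mulr_natr; field.
have lm : (0 < l - m)%N by lia.
rewrite mulr_gt0 ?pi_gt0 ?divr_gt0 ?ltr0n //= gtr_pMr ?pi_gt0 //.
by rewrite ltr_pdivrMr ?ltr0n // mul1r ltr_nat; lia.
Qed.

Lemma fourier_orthogonal (l m : nat) : (l < N)%N -> (m < N)%N ->
  \sum_(x < N) cos (freq * (l%:R - m%:R) * x%:R) = (N * (l == m))%:R /\
  \sum_(x < N) sin (freq * (l%:R - m%:R) * x%:R) = 0.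
Proof.
have lt_case a b : (b < a)%N -> (a < N)%N ->
    \sum_(x < N) cos (freq * (a%:R - b%:R) * x%:R) = 0 /\
    \sum_(x < N) sin (freq * (a%:R - b%:R) * x%:R) = 0.
  move=> ba aN; apply: sum_cos_sin_eq0; last by apply: freqB_neq1; rewrite ba.
  - by rewrite mulrBr mulrBl !freqN cosB !cos_2pin !sin_2pin; ring.
  - by rewrite mulrBr mulrBl !freqN sinB !cos_2pin !sin_2pin; ring.
move=> lN mN; have [lm|ml|->] := ltngtP l m; last first.
- rewrite muln1; split.
    rewrite (eq_bigr (fun=> 1)) => [|x _]; first by rewrite sumr_const card_ord.
    by rewrite subrr mulr0 mul0r cos0.
  by rewrite big1 // => x _; rewrite subrr mulr0 mul0r sin0.
- by rewrite muln0; apply: lt_case.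
rewrite muln0; have [C0 S0] := lt_case m l lm mN; split.
  rewrite -[RHS]C0; apply: eq_bigr => x _.
  by rewrite -opprB mulrN mulNr cosN.
rewrite -[RHS]oppr0 -[X in _ = - X]S0 -sumrN; apply: eq_bigr => x _.
by rewrite -opprB mulrN mulNr sinN.
Qed.

(** Real part of the inverse transform of [l |-> a l - 'i * b l]. *)
Definition fourier_inv (a b : nat -> R) (x : R) : R :=
  N%:R^-1 * \sum_(l < N) (a l * cos (freq * l%:R * x) + b l * sin (freq * l%:R * x)).

Lemma fourier_inv_period a b x : fourier_inv a b (x + N%:R) = fourier_inv a b x.
Proof.
congr (_ * _); apply: eq_bigr => l _.
rewrite mulrDr freqN cosD sinD cos_2pin sin_2pin.
by rewrite !mulr1 !mulr0 subr0 addr0.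
Qed.

(** Adding the square of the imaginary part [V] turns the left-hand side into
the squared norm of a complex transform, which orthogonality computes. *)
Lemma parseval_le a b : \sum_(x < N) fourier_inv a b x%:R ^+ 2 <=
  N%:R^-1 * \sum_(l < N) (a l ^+ 2 + b l ^+ 2).
Proof.
pose U x := \sum_(l < N) (a l * cos (freq * l%:R * x) + b l * sin (freq * l%:R * x)).
pose V x := \sum_(l < N) (a l * sin (freq * l%:R * x) - b l * cos (freq * l%:R * x)).
have UV x : U x ^+ 2 + V x ^+ 2 = \sum_(l < N) \sum_(m < N)
   ((a l * a m + b l * b m) * cos (freq * (l%:R - m%:R) * x) +
    (b l * a m - a l * b m) * sin (freq * (l%:R - m%:R) * x)).
  rewrite !expr2 !big_distrlr -big_split; apply: eq_bigr => l _ /=.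
  rewrite -big_split; apply: eq_bigr => m _ /=.
  have -> : freq * (l%:R - m%:R) * x = freq * l%:R * x - freq * m%:R * x by ring.
  by rewrite cosB sinB; ring.
have sumUV : \sum_(x < N) (U x%:R ^+ 2 + V x%:R ^+ 2) =
    N%:R * \sum_(l < N) (a l ^+ 2 + b l ^+ 2).
  under eq_bigr => x _ do rewrite UV.
  rewrite exchange_big mulr_sumr; apply: eq_bigr => l _ /=.
  rewrite exchange_big /= (bigD1 l) //= [X in _ + X]big1 => [|m /negPf ml]; last first.
    rewrite big_split /= -!mulr_sumr.
    have [-> ->] := fourier_orthogonal (ltn_ord l) (ltn_ord m).
    by rewrite -[(_ == _ :> nat)]/(l == m) eq_sym ml muln0 !mulr0 addr0.
  rewrite big_split /= -!mulr_sumr.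
  have [-> ->] := fourier_orthogonal (ltn_ord l) (ltn_ord l).
  by rewrite eqxx muln1; ring.
apply: (@le_trans _ _ (N%:R^-1 ^+ 2 * \sum_(x < N) (U x%:R ^+ 2 + V x%:R ^+ 2))).
  rewrite mulr_sumr; apply: ler_sum => x _.
  by rewrite exprMn ler_wpM2l ?sqr_ge0 // lerDl sqr_ge0.
by rewrite sumUV mulrA expr2 mulrVK ?unitfE.
Qed.

End Fourier.

(** * The renewal equation on a cyclic group *)
Section CyclicGreen.
Variables (R : realType) (p : nat -> R) (M N : nat).
Hypothesis p_ge0 : forall k, 0 <= p k.
Hypothesis MN : (M < N)%N.
Hypothesis mass_lt1 : 0 < tail p M.+1.

Local Notation w := (freq R N).

(** [char_re l] and [char_im l] are the real and imaginary parts of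
[1 - \sum_k p k * exp (- 'i * w * l * k)], the sum running over the increments
up to the cut-off [M]. *)
Definition char_re (l : nat) : R := 1 - \sum_(1 <= k < M.+1) p k * cos (w * l%:R * k%:R).
Definition char_im (l : nat) : R := \sum_(1 <= k < M.+1) p k * sin (w * l%:R * k%:R).

Let nrm l := char_re l ^+ 2 + char_im l ^+ 2.
(** The real part of the inverse transform of the reciprocal of that number:
the Green function of the walk on the cyclic group which is killed when its
increment exceeds [M]. *)
Definition green : R -> R :=
  fourier_inv N (fun l => char_re l / nrm l) (fun l => char_im l / nrm l).

Let N_gt0 : (0 < N)%N. Proof. exact: leq_ltn_trans MN. Qed.

Lemma green_period x : green (x + N%:R) = green x.
Proof. exact: fourier_inv_period. Qed.

Lemma char_re_gt0 l : 0 < char_re l.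
Proof.
apply: lt_le_trans mass_lt1 _; rewrite lerB // ler_sum // => k _.
by rewrite ler_piMr // cos_le1.
Qed.

Let nrm_gt0 l : 0 < nrm l.
Proof. by rewrite ltr_wpDr ?sqr_ge0 // exprn_gt0 // char_re_gt0. Qed.

Lemma green_eq x : green x =
  N%:R^-1 * (\sum_(l < N) cos (w * l%:R * x)) +
  \sum_(1 <= k < M.+1) p k * green (x - k%:R).
Proof.
rewrite /green /fourier_inv.
under [X in _ = _ + X]eq_bigr => k _ do rewrite mulrCA mulr_sumr.
rewrite -mulr_sumr exchange_big -mulrDr -big_split; congr (_ * _).
apply: eq_bigr => l _ /=; set t := w * l%:R.
under [X in _ = _ + X]eq_bigr => k _.
  have -> : p k * (char_re l / nrm l * cos (t * (x - k%:R)) +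
                   char_im l / nrm l * sin (t * (x - k%:R))) =
    (char_re l / nrm l * cos (t * x) + char_im l / nrm l * sin (t * x)) *
      (p k * cos (t * k%:R)) +
    (char_re l / nrm l * sin (t * x) - char_im l / nrm l * cos (t * x)) *
      (p k * sin (t * k%:R)) by rewrite mulrBr cosB sinB; ring.
  over.
rewrite /= big_split /= -!mulr_sumr -/(char_im l).
have -> : \sum_(1 <= k < M.+1) p k * cos (t * k%:R) = 1 - char_re l.
  by rewrite /char_re opprB addrC subrK.
have := nrm_gt0 l; rewrite /nrm => /lt0r_neq0; move: (char_re l) (char_im l) => a b ab.
by field.
Qed.

Lemma sum_cos_freq (n : nat) : (n < N)%N ->
  N%:R^-1 * (\sum_(l < N) cos (w * l%:R * n%:R)) = (n == 0%N)%:R.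
Proof.
move=> nN; have [] := fourier_orthogonal R N_gt0 nN N_gt0.
rewrite subr0; under eq_bigr => l _ do rewrite mulrAC.
by move=> -> _; rewrite natrM mulKf // pnatr_eq0 -lt0n.
Qed.

(** Minimum principle: the increments kept have total mass less than [1], so at
a negative minimum the renewal equation would give a value strictly above the
minimum. *)
Lemma green_ge0 (n : nat) : (n < N)%N -> 0 <= green n%:R.
Proof.
move=> nN; pose n0 := [arg min_(i < Ordinal nN) green (nat_of_ord i)%:R]%O.
have n0_min (i : 'I_N) : green n0%:R <= green i%:R.
  by rewrite /n0; case: Order.TotalTheory.arg_minP => // j _; apply.
apply: le_trans (n0_min (Ordinal nN)); rewrite leNgt; apply/negP => neg.
have := green_eq n0%:R; rewrite sum_cos_freq // => eq0.
have : (\sum_(1 <= k < M.+1) p k) * green n0%:R <= green n0%:R.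
  rewrite {2}eq0 ler_wpDl // mulr_suml; apply: ler_sum_nat => k /andP[k0 kM].
  rewrite ler_wpM2l //; have kN : (k < N)%N by lia.
  have [kn|nk] := leqP k n0.
    by rewrite -natrB //; apply: (n0_min (Ordinal (leq_ltn_trans (leq_subr k n0) (ltn_ord n0)))).
  rewrite -[green (_ - _)]green_period.
  have lt : (n0 + N - k < N)%N by lia.
  have -> : n0%:R - k%:R + N%:R = (n0 + N - k)%N%:R :> R by rewrite natrB ?natrD; [ring | lia].
  exact: (n0_min (Ordinal lt)).
by have := mass_lt1; rewrite /tail; nra.
Qed.

(** Compared with the renewal sequence, the cyclic equation has the additional
nonnegative terms of the walks that have gone around the cycle. *)
Lemma renewal_le_green (n : nat) : (n <= M)%N -> renewal p n <= green n%:R.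
Proof.
elim/ltn_ind: n => n IHn nM; rewrite renewalE green_eq.
rewrite sum_cos_freq ?(leq_ltn_trans nM) // lerD2l.
rewrite [leRHS](@big_cat_nat _ _ _ n.+1) //= ler_wpDr //.
  rewrite big_nat sumr_ge0 // => k /andP[nk kM]; rewrite mulr_ge0 //.
  rewrite -[green (_ - _)]green_period.
  have -> : n%:R - k%:R + N%:R = (n + N - k)%N%:R :> R by rewrite natrB ?natrD; [ring | lia].
  by apply: green_ge0; lia.
rewrite big_add1 /= big_mkord (reindex_inj rev_ord_inj) /=.
apply: ler_sum => i _; have i_n := ltn_ord i.
have -> : (n - (n - i.+1) = i.+1)%N by lia.
rewrite -natrB // ler_wpM2l // IHn //; lia.
Qed.

Lemma sum_renewal_sqr_le : \sum_(n < M.+1) renewal p n ^+ 2 <=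
  N%:R^-1 * \sum_(l < N) char_re l ^- 2.
Proof.
apply: (@le_trans _ _ (\sum_(n < N) green n%:R ^+ 2)).
  rewrite -(big_mkord xpredT (fun n => renewal p n ^+ 2)).
  rewrite -(big_mkord xpredT (fun n => green n%:R ^+ 2)).
  rewrite [leRHS](@big_cat_nat _ _ _ M.+1) //= ler_wpDr //.
    by apply: sumr_ge0 => i _; apply: sqr_ge0.
  apply: ler_sum_nat => n /andP[_ nM].
  by rewrite lerXn2r ?nnegrE ?renewal_ge0 ?green_ge0 ?renewal_le_green //; lia.
apply: le_trans (parseval_le N_gt0 _ _) _; rewrite ler_wpM2l ?invr_ge0 //.
apply: ler_sum => l _; rewrite !expr_div_n -mulrDl -/(nrm l).
have n0 := nrm_gt0 l; rewrite expr2 invfM mulrA divff ?lt0r_neq0 // mul1r.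
by rewrite lef_pV2 ?posrE ?exprn_gt0 ?char_re_gt0 // lerDl sqr_ge0.
Qed.

End CyclicGreen.

(** * Square summability *)
Lemma sum_trunc_log (R : pzRingType) (f : nat -> R) (j : nat) :
  \sum_(1 <= l < 2 ^ j) f (trunc_log 2 l) = \sum_(i < j) (2 ^ i)%:R * f i.
Proof.
elim: j => [|j IHj]; first by rewrite big_geq // big_ord0.
have lt2 : (2 ^ j <= 2 ^ j.+1)%N by rewrite leq_pexp2l.
rewrite (@big_cat_nat _ _ _ (2 ^ j)) ?expn_gt0 //= IHj big_ord_recr /=; congr (_ + _).
rewrite (eq_big_nat _ _ (F2 := fun=> f j)) => [|l jl]; last by rewrite (@trunc_log_eq 2 j).
by rewrite sumr_const_nat expnS mul2n -addnn addnK mulr_natl.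
Qed.

(** [n] is the quotient of [N] by [4 * l], rounded up. *)
Lemma quarter_block (l m N : nat) : (0 < l)%N -> (0 < m)%N -> (4 * l * m <= N)%N ->
  exists n, [/\ (m <= n)%N, (N <= 4 * l * n)%N, (4 * l * n.*2.-1 <= 3 * N)%N
              & (4 * l * n.-1 < N)%N].
Proof.
move=> l0 m0 lmN; have l4 : (0 < 4 * l)%N by rewrite muln_gt0.
move: (4 * l)%N l4 lmN => t t0 tmN.
have [|n n_lo n_min] := @ex_minnP (fun n => N <= t * n)%N.
  by exists N; rewrite leq_pmull.
have mn : (m <= n)%N by rewrite -(leq_pmul2l t0) (leq_trans tmN).
have n0 : (0 < n)%N by apply: leq_trans mn.
have n_hi : (t * n.-1 < N)%N by rewrite ltnNge; apply/negP => /n_min; lia.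
have tN : (t <= N)%N by apply: leq_trans tmN; rewrite leq_pmulr.
exists n; split => //; rewrite (_ : n.*2.-1 = n.-1 + n.-1 + 1)%N; last lia.
by rewrite !mulnDr muln1; lia.
Qed.

Section UniformBound.
Variables (R : realType) (p : nat -> R).
Hypothesis p_ge0 : forall k, 0 <= p k.
Hypothesis sum_p_le1 : forall n, \sum_(1 <= k < n) p k <= 1.

(** The increments beyond the cut-off count as if their cosine were [0]. *)
Lemma char_reE M N l :
  char_re p M N l = tail p M.+1 + \sum_(1 <= k < M.+1) p k * (1 - cos (freq R N * l%:R * k%:R)).
Proof.
rewrite /tail /char_re; under [X in _ = _ + X]eq_bigr => k _ do rewrite mulrBr mulr1.
by rewrite sumrB addrA subrK.
Qed.

Lemma char_re_sym M N l : (0 < N)%N -> (l <= N)%N -> char_re p M N (N - l) = char_re p M N l.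
Proof.
move=> N0 lN; congr (1 - _); apply: eq_bigr => k _; congr (_ * _).
rewrite natrB // mulrBr mulrBl.
rewrite [freq R N * N%:R * _]mulrAC freqN // cosB cos_2pin sin_2pin mul1r mul0r addr0 //.
Qed.

(** The part of the block beyond the cut-off is covered by the term
[tail p M.+1], which makes the bound uniform in [M]. *)
Lemma block_le (f : nat -> R) (n m M : nat) : (0 < n <= m)%N ->
  (forall k, 0 <= f k) -> (forall k, (n <= k < m)%N -> 1 <= f k) ->
  tail p n - tail p m <= tail p M.+1 + \sum_(1 <= k < M.+1) p k * f k.
Proof.
move=> /andP[n0 nm] f0 f1.
have pf0 a b : 0 <= \sum_(a <= k < b) p k * f k by apply: sumr_ge0 => k _; rewrite mulr_ge0.
have block a b : (0 < a <= b)%N -> tail p a - tail p b = \sum_(a <= k < b) p k.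
  by move=> /andP[a0 ab]; rewrite /tail [X in _ - (1 - X)](@big_cat_nat _ _ _ a) //=; ring.
have [Mn|nM] := leqP M.+1 n.
  apply: (@le_trans _ _ (tail p M.+1)); last by rewrite lerDl.
  by have := le_tail p_ge0 Mn; have := tail_ge0 sum_p_le1 m; lra.
have [mM|Mm] := leqP m M.+1.
  apply: ler_wpDl; first exact: tail_ge0.
  rewrite block ?n0 // [leRHS](@big_cat_nat _ _ _ n) //= ?(leq_trans nm) // ler_wpDl //.
  rewrite [leRHS](@big_cat_nat _ _ _ m) //= ler_wpDr //.
  by apply: ler_sum_nat => k kn; rewrite ler_peMr ?f1.
apply: (@le_trans _ _ (tail p n)); first by rewrite gerBl tail_ge0.
rewrite -lerBlDl block ?n0 ?(ltnW nM) // [leRHS](@big_cat_nat _ _ _ n) //= 1?ltnW //.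
rewrite ler_wpDl //; apply: ler_sum_nat => k kn; rewrite ler_peMr ?f1 //; lia.
Qed.

Lemma cos_le0 (x : R) : pi / 2 <= x <= pi / 2 + pi -> cos x <= 0.
Proof.
move=> /andP[x1 x2]; rewrite -[x](subrK pi) cosDpi oppr_le0.
by apply: cos_ge0_pihalf; rewrite lerNl opprB; apply/andP; split; have := pi_gt0 R; lra.
Qed.

(** For [k] between [n] and [2 * n - 1] the angle lies between a quarter and
three quarters of a turn, where the cosine is nonpositive. *)
Lemma char_re_ge_block M N l n : (0 < n)%N -> (0 < N)%N ->
  (N <= 4 * l * n)%N -> (4 * l * n.*2.-1 <= 3 * N)%N ->
  tail p n - tail p (2 * n) <= char_re p M N l.
Proof.
move=> n0 N0 lo hi; rewrite char_reE; apply: block_le => [|k|k].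
- by rewrite n0 leq_pmull.
- by rewrite subr_ge0 cos_le1.
move=> /andP[nk kn]; rewrite lerBrDr gerDl; apply: cos_le0.
have -> : freq R N * l%:R * k%:R = pi * ((2 * l * k)%:R / N%:R).
  by rewrite /freq !natrM -mulr_natr; ring.
have -> : pi / 2 + pi = pi * (3 / 2) :> R by field.
rewrite !ler_pM2l ?pi_gt0 // ler_pdivlMr ?ltr0n // ler_pdivrMr ?ltr0n //.
have h1 : (N <= 4 * l * k)%N by rewrite (leq_trans lo) // leq_mul.
have h2 : (4 * l * k <= 3 * N)%N by rewrite (leq_trans _ hi) // leq_mul //; lia.
move: h1 h2; rewrite -!(ler_nat R) !natrM => h1 h2; apply/andP; split; lra.
Qed.

(** The integers [x] for which [sin (t * x) ^+ 2] obeys such a bound form a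
subgroup, by the addition formula, and this subgroup contains the support. *)
Lemma sin_sqr_mass :
  (forall e, (forall n, (0 < n)%N /\ 0 < p n -> (e %| n)%N) -> (e %| 1)%N) ->
  exists2 C, 0 < C & exists M0, forall M, (M0 <= M)%N -> forall t,
    sin t ^+ 2 <= C * \sum_(1 <= k < M.+1) p k * sin (t * k%:R) ^+ 2.
Proof.
move=> p_gcd.
pose S (x : int) := exists2 C, 0 < C & exists M0, forall M, (M0 <= M)%N -> forall t,
    sin (t * x%:~R) ^+ 2 <= C * \sum_(1 <= k < M.+1) p k * sin (t * k%:R) ^+ 2.
suff /(_ 1) [C C0 [M0 h]] : forall x, S x.
  by exists C => //; exists M0 => M MM t; rewrite -[t in X in X <= _]mulr1; apply: h.
apply: (gcd1_subgroup p_gcd) => [x y [C C0 [M1 hx]] [D D0 [M2 hy]]|k [k0 pk]].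
  exists (2 * (C + D)); first by rewrite mulr_gt0 ?addr_gt0.
  exists (maxn M1 M2) => M; rewrite geq_max => /andP[/hx{}hx /hy{}hy] t.
  have := hx t; have := hy t; set T := \sum_(_ <= _ < _) _.
  rewrite rmorphB mulrBr sinB; set a := t * x%:~R; set b := t * y%:~R => hb ha.
  have c1 := cos2Dsin2 a; have c2 := cos2Dsin2 b.
  have sq : (sin a * cos b - cos a * sin b) ^+ 2 <=
      2 * ((sin a * cos b) ^+ 2 + (cos a * sin b) ^+ 2).
    by have := sqr_ge0 (sin a * cos b + cos a * sin b); nra.
  apply: (le_trans sq); rewrite -mulrA ler_pM2l // mulrDl; apply: lerD.
    by apply: le_trans ha; rewrite exprMn ler_piMr ?sqr_ge0 //; have := sqr_ge0 (sin b); lra.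
  by apply: le_trans hb; rewrite exprMn ler_piMl ?sqr_ge0 //; have := sqr_ge0 (sin a); lra.
exists (p k)^-1; first by rewrite invr_gt0.
exists k => M kM t; rewrite ler_pdivlMl // -pmulrn.
rewrite (bigD1_seq k) ?iota_uniq //= ?mem_index_iota ?k0 ?ltnS // lerDl.
by apply: sumr_ge0 => i _; rewrite mulr_ge0 ?sqr_ge0.
Qed.

Lemma char_re_ge_sin (C : R) M N l : (0 < N)%N -> 0 < C ->
  (forall t, sin t ^+ 2 <= C * \sum_(1 <= k < M.+1) p k * sin (t * k%:R) ^+ 2) ->
  sin (pi * (l%:R / N%:R)) ^+ 2 / C <= char_re p M N l.
Proof.
move=> N0 C0 /(_ (pi * (l%:R / N%:R))) h; rewrite char_reE ler_wpDl ?tail_ge0 //.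
rewrite ler_pdivrMr // [leRHS]mulrC; apply: le_trans h _; rewrite ler_pM2l //.
apply: ler_sum => k _; rewrite ler_wpM2l //.
rewrite [cos _]cosE_sin_half.
have -> : freq R N * l%:R * k%:R / 2 = pi * (l%:R / N%:R) * k%:R.
  by rewrite /freq -mulr_natr; field; rewrite pnatr_eq0 -lt0n.
set y := sin _ ^+ 2; have -> : 1 - (1 - 2 * y) = y + y by ring.
by rewrite lerDl sqr_ge0.
Qed.

Lemma tail_pow2_ge (rho : R) (n0 : nat) : 0 < rho -> rho < 1 -> (forall n, 0 < tail p n) ->
  (forall n, (n0 <= n)%N -> rho * tail p n <= tail p (2 * n)) ->
  exists2 c, 0 < c & forall j, c * rho ^+ j <= tail p (2 ^ j).
Proof.
move=> rho0 rho1 tail_gt0 decay; exists (tail p (2 ^ n0)) => // j.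
have [jn0|/ltnW/subnKC <-] := leqP j n0.
  apply: (@le_trans _ _ (tail p (2 ^ n0))); last by rewrite le_tail // leq_pexp2l.
  by rewrite ler_piMr ?exprn_ile1 ?ltW.
elim: (j - n0)%N => [|i IHi].
  by rewrite addn0 ler_piMr ?exprn_ile1 ?ltW.
rewrite addnS exprS expnS mulrCA; apply: le_trans (decay _ _).
  by rewrite ler_pM2l.
by rewrite (leq_trans _ (ltnW (ltn_expl _ _))) // leq_addr.
Qed.

(** Low frequencies are handled by the block of increments between [N / 4 l]
and twice that number, on which the mass is a fixed fraction of the tail.  This
requires [N / 4 l] to exceed the scale from which the decay of the tail is
known; otherwise [l / N] is bounded below and [char_re_ge_sin] applies. *)
Lemma char_re_dyadic (rho sigma : R) (n0 : nat) :
  0 < rho -> rho < 1 -> sigma < 1 -> (forall n, 0 < tail p n) ->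
  (forall n, (n0 <= n)%N -> rho * tail p n <= tail p (2 * n) <= sigma * tail p n) ->
  (forall e, (forall n, (0 < n)%N /\ 0 < p n -> (e %| n)%N) -> (e %| 1)%N) ->
  exists2 c, 0 < c & exists M0, forall M j i l, (M0 <= M)%N ->
    (2 ^ i <= l)%N -> (2 * l <= 2 ^ j)%N -> c * rho ^+ (j - i) <= char_re p M (2 ^ j) l.
Proof.
move=> rho0 rho1 sigma1 tail_gt0 decay p_gcd.
have [c1 c1_gt0 tail_ge] : exists2 c, 0 < c & forall j, c * rho ^+ j <= tail p (2 ^ j).
  by apply: (@tail_pow2_ge rho n0) => // n /decay/andP[].
have [C C0 [M0 sin_le]] := sin_sqr_mass p_gcd.
pose m := maxn n0 1; have m0 : (0 < m)%N by rewrite leq_max orbT.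
pose s : R := sin (pi / (4 * m)%:R).
have pi0 := pi_gt0 R.
have m4 : 4 <= (4 * m)%:R :> R by rewrite ler_nat leq_pmulr.
have s0 : 0 < s.
  by apply: sin_gt0_pi; rewrite divr_gt0 //= ?ltr_pdivrMr ?ltr_pMr //; lra.
have [c [c_gt0 c_block c_sin]] : exists c, [/\ 0 < c, c <= (1 - sigma) * c1 & c <= s ^+ 2 / C].
  exists (Num.min ((1 - sigma) * c1) (s ^+ 2 / C)); split; rewrite ?ge_min ?lexx ?orbT //.
  by rewrite lt_min mulr_gt0 ?subr_gt0 // divr_gt0 // exprn_gt0.
exists c => //; exists M0 => M j i l MM il lj; set N := (2 ^ j)%N.
have N0 : (0 < N)%N by rewrite expn_gt0.
have l0 : (0 < l)%N by rewrite (leq_trans _ il) // expn_gt0.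
have [near0|far0] := leqP (4 * l * m)%N N.
  have [n [mn n_lo n_mid n_hi]] := quarter_block l0 m0 near0.
  have n_gt0 : (0 < n)%N by apply: leq_trans mn.
  apply: (@le_trans _ _ (tail p n - tail p (2 * n))); last exact: char_re_ge_block.
  have ij : (i.+2 <= j)%N.
    rewrite -(@leq_exp2l 2) //; apply: leq_trans near0.
    by rewrite (leq_trans _ (leq_pmulr _ m0)) // !expnS mulnA leq_mul.
  have n_le : (n <= 2 ^ (j - i.+2))%N.
    have : (4 * l * n.-1 < 4 * l * 2 ^ (j - i.+2))%N.
      apply: leq_trans n_hi _; rewrite -/N /N -(subnKC ij) expnD addKn leq_mul //.
      by rewrite !expnS mulnA leq_mul.
    by rewrite ltn_pmul2l ?muln_gt0 // prednK.
  have /andP[_ dec] : rho * tail p n <= tail p (2 * n) <= sigma * tail p n.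
    by apply: decay; apply: leq_trans mn; rewrite leq_max leqnn.
  apply: (@le_trans _ _ ((1 - sigma) * tail p n)); last by lra.
  apply: (@le_trans _ _ ((1 - sigma) * (c1 * rho ^+ (j - i.+2)))); last first.
    by rewrite ler_pM2l ?subr_gt0 // (le_trans (tail_ge _)) // le_tail.
  rewrite mulrA; apply: ler_pM => //; rewrite ?exprn_ge0 ?(ltW rho0) ?(ltW c_gt0) //.
  by rewrite ler_wiXn2l ?(ltW rho0) ?(ltW rho1) // leq_sub2l // leqW.
apply: le_trans (char_re_ge_sin l N0 C0 (sin_le M MM)).
apply: (@le_trans _ _ (s ^+ 2 / C)).
  by apply: le_trans c_sin; rewrite ler_piMr ?exprn_ile1 ?ltW.
move: lj; rewrite -/N => lN; clearbody N m.
have NR : 0 < N%:R :> R by rewrite ltr0n.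
have lNR : l%:R / N%:R <= 2^-1 :> R.
  by rewrite ler_pdivrMr // mulrC ler_pdivlMr // -natrM ler_nat mulnC.
have mR : ((4 * m)%:R)^-1 <= l%:R / N%:R :> R.
  rewrite ler_pdivlMr // ler_pdivrMl; last by lra.
  by rewrite -natrM ler_nat mulnAC ltnW.
have m4i : 0 < ((4 * m)%:R)^-1 :> R by rewrite invr_gt0; lra.
have lo : pi / (4 * m)%:R <= pi * (l%:R / N%:R) :> R by rewrite ler_pM2l.
have hi : pi * (l%:R / N%:R) <= pi / 2 :> R by rewrite ler_pM2l.
have lo0 : 0 < pi / (4 * m)%:R :> R by rewrite mulr_gt0.
rewrite /s; set x := pi / _ in lo lo0 *; set y := pi * (l%:R / _) in lo hi *.
have x_pi : x <= pi by lra.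
have x_in : x \in `[- (pi / 2), pi / 2] by rewrite in_itv /=; apply: (introT andP); split; lra.
have y_in : y \in `[- (pi / 2), pi / 2] by rewrite in_itv /=; apply: (introT andP); split; lra.
have sxy : sin x <= sin y by rewrite leNgt ltr_sin // -leNgt.
have sx : 0 <= sin x by rewrite sin_ge0_pi // (ltW lo0).
by rewrite ler_pM2r ?invr_gt0 // lerXn2r ?nnegrE // (le_trans sx).
Qed.

(** Frequencies with binary logarithm [i] number [2 ^ i] and contribute at most
a multiple of [rho ^- 2 ^+ (j - i)] each; divided by [N = 2 ^ j] the total is
dominated by a geometric series of ratio [(2 * rho ^+ 2)^-1]. *)
Lemma renewal_sqr_summable (rho sigma : R) (n0 : nat) :
  1 < 2 * rho ^+ 2 -> 0 < rho -> rho < 1 -> sigma < 1 -> (forall n, 0 < tail p n) ->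
  (forall n, (n0 <= n)%N -> rho * tail p n <= tail p (2 * n) <= sigma * tail p n) ->
  (forall e, (forall n, (0 < n)%N /\ 0 < p n -> (e %| n)%N) -> (e %| 1)%N) ->
  exists B, forall N, \sum_(n < N) renewal p n ^+ 2 <= B.
Proof.
move=> rho2 rho0 rho1 sigma1 tail_gt0 decay p_gcd.
have [c c0 [M0 char_ge]] := char_re_dyadic rho0 rho1 sigma1 tail_gt0 decay p_gcd.
pose r := rho ^- 2; have r0 : 0 < r by rewrite invr_gt0 exprn_gt0.
have r2 : r < 2 by rewrite /r -div1r ltr_pdivrMr ?exprn_gt0.
pose D := r / (2 - r); have D0 : 0 < D by rewrite divr_gt0 // subr_gt0.
have DE : D * (2 - r) = r by rewrite /D divfK // gt_eqF // subr_gt0.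
have geo j : \sum_(i < j) (2 ^ i)%:R * r ^+ (j - i) <= D * (2 ^ j)%:R.
  elim: j => [|j IHj]; first by rewrite big_ord0 expn0 mulr1 ltW.
  rewrite big_ord_recr /= subSnn expr1.
  rewrite (eq_bigr (fun i : 'I_j => r * ((2 ^ i)%:R * r ^+ (j - i)))); last first.
    by move=> i _; rewrite subSn ?exprS ?(ltnW (ltn_ord i)) //; ring.
  rewrite -mulr_sumr expnS natrM.
  have : r * \sum_(i < j) (2 ^ i)%:R * r ^+ (j - i) <= r * (D * (2 ^ j)%:R) by rewrite ler_pM2l.
  set P := (2 ^ j)%:R; have : D * P * (2 - r) = r * P by rewrite mulrAC DE.
  by set T := \sum_(_ < _) _; lra.
(* [1] accounts for the frequency [0], once [2 ^ j] exceeds [tail p M.+1 ^- 2];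
   the factor [2] accounts for the symmetry between [l] and [N - l]. *)
exists (1 + 2 * (c ^- 2 * D)) => M1.
pose M := maxn M0 M1; have MM : (M0 <= M)%N by rewrite leq_max leqnn.
apply: (@le_trans _ _ (\sum_(n < M.+1) renewal p n ^+ 2)).
  rewrite -!(big_mkord xpredT (fun n => renewal p n ^+ 2)) [leRHS](@big_cat_nat _ _ _ M1) //=.
    by rewrite lerDl sumr_ge0 // => k _; rewrite sqr_ge0.
  by rewrite leqW // leq_max leqnn orbT.
have [j [Mj jt]] : exists j, (M < 2 ^ j)%N /\ tail p M.+1 ^- 2 <= (2 ^ j)%:R.
  exists (maxn M (Num.bound (tail p M.+1 ^- 2))); split.
    by apply: (leq_ltn_trans (leq_maxl M _)); apply: ltn_expl.
  by rewrite natrX; apply/ltW/upper_nthrootP; rewrite leq_max leqnn orbT.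
pose N := (2 ^ j)%N; have N0 : (0 < N)%N by rewrite expn_gt0.
have NR : 0 < N%:R :> R by rewrite ltr0n.
apply: le_trans (sum_renewal_sqr_le p_ge0 Mj (tail_gt0 _)) _.
rewrite -/N ler_pdivrMl // -(big_mkord xpredT (fun l => char_re p M N l ^- 2)) big_ltn //.
rewrite mulrDr mulr1; apply: lerD.
  rewrite [char_re _ _ _ _](_ : _ = tail p M.+1) //.
  congr (1 - _); apply: eq_bigr => k _; by rewrite mulr0 mul0r cos0 mulr1.
pose G l := c ^- 2 * r ^+ (j - trunc_log 2 l).
have half l : (0 < l)%N -> (2 * l <= N)%N -> char_re p M N l ^- 2 <= G l.
  move=> l0 lN; have tl := trunc_logP (isT : (1 < 2)%N) l0.
  have := char_ge M j _ l MM tl lN; rewrite -/N.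
  have cr : 0 < c * rho ^+ (j - trunc_log 2 l) by rewrite mulr_gt0 ?exprn_gt0.
  move=> h; have -> : G l = (c * rho ^+ (j - trunc_log 2 l)) ^- 2.
    by rewrite /G /r exprMn [RHS]invfM exprVn -!exprM mulnC.
  rewrite lef_pV2 ?posrE ?exprn_gt0 ?(lt_le_trans cr) //.
  by rewrite lerXn2r ?nnegrE ?(ltW cr) // (le_trans (ltW cr)).
have G0 l : 0 <= G l.
  by rewrite mulr_ge0 // ?exprn_ge0 ?(ltW r0) // invr_ge0 exprn_ge0 // ltW.
apply: (@le_trans _ _ (\sum_(1 <= l < N) (G l + G (N - l)%N))).
  apply: ler_sum_nat => l /andP[l0 lN].
  have [h|h] := leqP (2 * l)%N N; first by rewrite ler_wpDr ?half.
  by rewrite ler_wpDl // -(char_re_sym M N0 (ltnW lN)) half //; lia.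
rewrite big_split /= [X in _ + X]big_nat_rev /=.
rewrite [X in _ + X](eq_big_nat _ _ (F2 := G)) => [|l /andP[l0 lN]]; last by congr G; lia.
have -> : \sum_(1 <= l < N) G l = c ^- 2 * \sum_(i < j) (2 ^ i)%:R * r ^+ (j - i).
  by rewrite -(sum_trunc_log (fun i => r ^+ (j - i))) mulr_sumr.
have := geo j; rewrite -/N; set T := \sum_(_ < _) _ => h.
have : c ^- 2 * T <= c ^- 2 * (D * N%:R) by rewrite ler_pM2l // invr_gt0 exprn_gt0.
by lra.
Qed.

End UniformBound.

(** * Distant lines rarely meet *)
Section Transience.
Variables (R : realType) (p : nat -> R).
Hypothesis p_ge0 : forall k, 0 <= p k.

Lemma meet_prob_le_sum (a b : nat) : (b <= a)%N ->
  meet_prob p a b <= \sum_(m < b.+1) renewal p (m + (a - b)) * renewal p m.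
Proof.
move=> ba; apply: le_trans (meet_prob_le_common_renewals p_ge0 (ltnSn a) _) _; first by rewrite ltnS.
rewrite /common_renewals -(big_mkord xpredT (fun c => renewal_from p a c * renewal_from p b c)).
rewrite (@big_cat_nat _ _ _ b.+1) //= [X in _ + X]big1_seq ?addr0; last first.
  move=> c; rewrite mem_index_iota => /and3P[_ bc _].
  by rewrite [renewal_from p b c]/renewal_from leqNgt bc mulr0.
rewrite big_mkord (reindex_inj rev_ord_inj) le_eqVlt; apply/orP; left; apply/eqP.
apply: eq_bigr => m _ /=; have mb : (m <= b)%N by rewrite -ltnS.
rewrite /renewal_from subSS leq_subr (leq_trans (leq_subr m b) ba) subKn //.
by congr (renewal p _ * _); lia.
Qed.

(** The sum of [meet_prob_le_sum] correlates [renewal p] with its translate by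
[a - b].  The inequality [2 x y <= t x ^ 2 + y ^ 2 / t] splits it into a full
sum of squares with a small coefficient and a sum of squares over the indices
from [D] on, which is small by summability. *)
Lemma meet_prob_small (B eps : R) : 0 < eps ->
  (forall N, \sum_(n < N) renewal p n ^+ 2 <= B) ->
  exists D, forall a b, (b + D <= a)%N -> meet_prob p a b <= eps.
Proof.
move=> eps0 sqB; pose q n := renewal p n ^+ 2.
have B1 : 1 <= B by have := sqB 1%N; rewrite big_ord1 renewal0 expr1n.
have B0 : 0 < B by lra.
pose t := eps / B; have t0 : 0 < t by rewrite divr_gt0.
have tB : t * B = eps by rewrite /t divfK // gt_eqF.
clearbody t; pose S := [set \sum_(n < N) q n | N in setT].
have supS : has_sup S.
  by split; [exists (\sum_(n < 0) q n); exists 0%N | exists B => _ [N _ <-]].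
have [_ [D _ <-] hD] := @sup_adherent _ S (eps * t) (mulr_gt0 eps0 t0) supS.
exists D => a b ab; have ba : (b <= a)%N by lia.
apply: le_trans (meet_prob_le_sum ba) _.
have q0 n : 0 <= q n by rewrite /q sqr_ge0.
have tail_le : \sum_(m < b.+1) q (m + (a - b))%N <= eps * t.
  have : \sum_(n < D + (a - b - D + b.+1)) q n <= sup S.
    by apply: sup_upper_bound => //; exists (D + (a - b - D + b.+1))%N.
  rewrite big_split_ord /= big_split_ord /=.
  rewrite [X in _ + (_ + X) <= _](eq_bigr (fun m : 'I_b.+1 => q (m + (a - b))%N)).
    have : 0 <= \sum_(i < a - b - D) q (D + i)%N by apply: sumr_ge0.
    by move: hD; lra.
  by move=> m _; congr q; rewrite addnA subnKC 1?addnC //; lia.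
apply: (@le_trans _ _ (\sum_(m < b.+1) (t / 2 * q m + (2 * t)^-1 * q (m + (a - b))%N))).
  apply: ler_sum => m _; rewrite /q; move: (renewal p _) (renewal p _) => x y.
  have {1}-> : y * x = (2 * t)^-1 * (2 * t * x * y) by field; rewrite gt_eqF.
  have {1}-> : t / 2 * x ^+ 2 = (2 * t)^-1 * (t * x) ^+ 2 by field; rewrite gt_eqF.
  rewrite -mulrDr ler_pM2l ?invr_gt0 ?mulr_gt0 //.
  by have := sqr_ge0 (t * x - y); nra.
rewrite big_split /= -!mulr_sumr.
have h1 : t / 2 * \sum_(m < b.+1) q m <= eps / 2.
  by rewrite -tB [t / 2 * _]mulrAC ler_pM2r ?invr_gt0 // ler_pM2l // sqB.
have h2 : (2 * t)^-1 * \sum_(m < b.+1) q (m + (a - b))%N <= eps / 2.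
  rewrite (_ : eps / 2 = (2 * t)^-1 * (eps * t)); last by field; rewrite gt_eqF.
  by rewrite ler_pM2l ?invr_gt0 ?mulr_gt0.
lra.
Qed.

End Transience.

(** * Ancestral lines in the graph *)
Section Lineages.

(** The same exploration as in [meet_step], for given jumps [f]. *)
Definition meets_step (f : nat -> nat) (u : nat * nat -> bool) (x : nat * nat) : bool :=
  if x.1 == x.2 then true
  else if (x.2 < x.1)%N then
    [exists i : 'I_x.1, (f x.1 == x.1 - i)%N && u (nat_of_ord i, x.2)]
  else [exists i : 'I_x.2, (f x.2 == x.2 - i)%N && u (x.1, nat_of_ord i)].

Definition meets (f : nat -> nat) (a b : nat) : bool :=
  strong_rec false (fun x : nat * nat => (x.1 + x.2)%N) (meets_step f) (a, b).

Lemma meetsE f a b : meets f a b =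
  if a == b then true
  else if (b < a)%N then [exists i : 'I_a, (f a == a - i)%N && meets f i b]
  else [exists i : 'I_b, (f b == b - i)%N && meets f a i].
Proof.
rewrite {1}/meets strong_recE // => u v [x y] uv; rewrite /meets_step /=.
case: eqP => // /eqP neq_xy; case: ltnP => xy.
- by apply: eq_existsb => i; rewrite uv //= ltn_add2r.
- by apply: eq_existsb => i; rewrite uv //= ltn_add2l.
Qed.

Lemma meets_diag f a : meets f a a.
Proof. by rewrite meetsE eqxx. Qed.

Lemma meets_gt f a b : (b < a)%N ->
  meets f a b = [exists i : 'I_a, (f a == a - i)%N && meets f i b].
Proof. by move=> ba; rewrite meetsE ba; case: eqP ba => // ->; rewrite ltnn. Qed.

Lemma meetsC f a b : meets f a b = meets f b a.
Proof.
have [n] := ubnP (a + b); elim: n a b => // n IHn a b abn.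
rewrite meetsE [RHS]meetsE eq_sym; case: eqP => // /eqP ab.
by have [ba|ba|/eqP] := ltngtP a b; last (by rewrite eq_sym (negPf ab));
  apply: eq_existsb => i; rewrite IHn //; have := ltn_ord i; lia.
Qed.

Lemma meets_succ f g a b : (forall n, g n.+1 = f n) -> meets f a b -> meets g a.+1 b.+1.
Proof.
move=> fg; move: a b; apply: meet_ind => [a b|a _ _|a b ba IH].
- by rewrite meetsC [meets g b.+1 _]meetsC.
- exact: meets_diag.
- rewrite !meets_gt // => /existsP[i /andP[fi mi]].
  apply/existsP; exists (lift ord0 i); rewrite lift0 fg subSS fi /=.
  by apply: IH.
Qed.

Variable f : int -> nat.

Definition window (z : int) (n : nat) : nat := f (z + n%:Z).

Definition ancestor (x : int) : int := x - (f x)%:Z.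

Lemma component_sym x y : component (jump_graph f) x y -> component (jump_graph f) y x.
Proof.
elim=> [u v uv|u|u v w _ uv _ vw]; [|exact: rt_refl|exact: rt_trans uv].
by apply: rt_step; case: uv; [right | left].
Qed.

Lemma meets_component z a b :
  meets (window z) a b -> component (jump_graph f) (z + a%:Z) (z + b%:Z).
Proof.
move: a b; apply: meet_ind => [a b ab|a _ _|a b ba IH].
- by rewrite meetsC => /ab/component_sym.
- exact: rt_refl.
rewrite meets_gt // => /existsP[i /andP[/eqP fa /(IH _ (ltn_ord i))]].
apply: rt_trans; apply: rt_step; left; rewrite /jump_graph.
by move: fa; rewrite /window => ->; have := ltn_ord i; lia.
Qed.

(** In the graph of a function, two paths out of the same vertex follow the
same iterates, which gives transitivity. *)
Lemma component_ancestor x y : component (jump_graph f) x y ->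
  exists n m, iter n ancestor x = iter m ancestor y.
Proof.
elim=> [u v [|] ->|u|u v w _ [n [m uv]] _ [n' [m' vw]]].
- by exists 1%N, 0%N.
- by exists 0%N, 1%N.
- by exists 0%N, 0%N.
- by exists (n' + n)%N, (m + m')%N; rewrite !iterD uv -vw -!iterD addnC.
Qed.

Lemma iter_ancestor_le n x : iter n ancestor x <= x.
Proof. by elim: n => //= n; rewrite /ancestor; lia. Qed.

Hypothesis f_gt0 : forall x, (0 < f x)%N.

(** A common point of the two lines lies below both starting points, so the
higher line must make at least one step to reach it; positivity of the jumps
makes this step strict. *)
Lemma ancestor_meets z a b n m : iter n ancestor (z + a%:Z) = iter m ancestor (z + b%:Z) ->
  z <= iter n ancestor (z + a%:Z) -> meets (window z) a b.
Proof.
move: a b n m; apply: meet_ind => [a b ab n m e le|a _ n m _ _|a b ba IH [|n] m].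
- by rewrite meetsC (ab m n) // -e.
- exact: meets_diag.
- by have := iter_ancestor_le m (z + b%:Z) => /[swap] /= <-; lia.
rewrite iterSr meets_gt // => e le.
have fa : (f (z + a%:Z) <= a)%N.
  have := le_trans le (iter_ancestor_le n (ancestor (z + a%:Z))).
  by rewrite /ancestor; lia.
have lt_a : (a - f (z + a%:Z) < a)%N by have := f_gt0 (z + a%:Z); lia.
have anc : ancestor (z + a%:Z) = z + (a - f (z + a%:Z))%N%:Z by rewrite /ancestor; lia.
apply/existsP; exists (Ordinal lt_a); rewrite /= /window subKn // eqxx /=.
by apply: (IH _ lt_a n m); rewrite -anc.
Qed.

(** It suffices to lower the base to a common ancestor. *)
Lemma component_meets z a b : component (jump_graph f) (z + a%:Z) (z + b%:Z) ->
  exists c : nat, meets (window (z - c%:Z)) (a + c) (b + c).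
Proof.
move=> /component_ancestor[n [m e]]; set v := iter n _ _ in e.
exists (`|z - v|)%N; set c := `|z - v|%N.
have shift d : z - c%:Z + (d + c)%N%:Z = z + d%:Z by lia.
by apply: (@ancestor_meets _ _ _ n m); rewrite !shift // -/v /c; lia.
Qed.

End Lineages.

Lemma infinite_components (V : Type) (E : V -> V -> Prop) :
  (forall r, exists x : 'I_r -> V, forall i j : 'I_r, (i < j)%N -> ~ component E (x i) (x j)) ->
  infinite_set (components E).
Proof.
move=> distinct /finite_seqP[s sE]; have [x x_distinct] := distinct (size s).+1.
have comp_refl v : component E v v by exact: rt_refl.
have inj : injective (fun i => component E (x i)).
  move=> i j eij; apply: val_inj; have [ij|ji|//] := ltngtP (val i) (val j).
    by case: (x_distinct _ _ ij); rewrite eij.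
  by case: (x_distinct _ _ ji); rewrite -eij.
have /uniq_leq_size : uniq [seq component E (x i) | i <- enum 'I_(size s).+1].
  by rewrite map_inj_uniq ?enum_uniq.
move=> /(_ s); rewrite size_map size_enum_ord ltnn => h; suff: false by []; apply: h.
move=> _ /mapP[i _ ->]; have : [set` s] (component E (x i)) by rewrite -sE; exists (x i).
by [].
Qed.

(** * Probability of meeting *)
Section Law.
Variables (R : realType) (mu : probability nat R).
Hypothesis mu0 : mu [set 0%N] = 0%E.

Definition mass (n : nat) : R := fine (mu [set n]).

Lemma massE n : mu [set n] = (mass n)%:E.
Proof. by rewrite fineK // fin_num_measure. Qed.

Lemma mass_ge0 n : 0 <= mass n.
Proof. by rewrite fine_ge0. Qed.

Lemma tail_massE n : (0 < n)%N -> mu [set m | (n <= m)%N] = (tail mass n)%:E.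
Proof.
case: n => // n _; elim: n => [|n IHn].
  rewrite tail1 (_ : [set m | _] = ~` [set 0%N]); last by apply/seteqP; split => m /=; rewrite lt0n => /eqP.
  by rewrite probability_setC // mu0 sube0.
have : mu [set m | (n.+1 <= m)%N] = (mu [set n.+1] + mu [set m | (n.+2 <= m)%N])%E.
  rewrite -measureU //; last by apply/seteqP; split => m //= [-> /=]; rewrite ltnn.
  congr (mu _); apply/seteqP; split => m /=.
    by rewrite leq_eqVlt => /predU1P[|]; [left | right].
  by case=> [->|/ltnW].
rewrite IHn massE => e.
have fin : mu [set m | (n.+2 <= m)%N] \is a fin_num by rewrite fin_num_measure.
by move: e; rewrite -(fineK fin) -EFinD => -[e]; rewrite [in RHS]tailS // e addrC addKr.
Qed.

Lemma sum_mass_le1 n : \sum_(1 <= k < n) mass k <= 1.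
Proof.
case: n => [|n]; first by rewrite big_geq.
by rewrite -subr_ge0 -[_ - _]/(tail mass n.+1) -lee_fin -tail_massE.
Qed.

End Law.

Section Almost.
Variables (R : realType) (d : measure_display) (Omega : measurableType d).
Variable P : probability Omega R.

Lemma negligible_eps (S : set Omega) :
  (forall e : R, 0 < e -> exists B, [/\ measurable B, S `<=` B & (P B <= e%:E)%E]) ->
  P.-negligible S.
Proof.
move=> small.
have /choice[B hB] : forall n : nat, exists B, [/\ measurable B, S `<=` B & (P B <= (n.+1%:R^-1)%:E)%E].
  by move=> n; apply: small; rewrite invr_gt0.
exists (\bigcap_n B n); split.
- by apply: bigcapT_measurable => n; case: (hB n).
- apply/eqP; rewrite eq_le measure_ge0 andbT; apply/lee_addgt0Pr => e e0.
  rewrite add0e; have [n ne] : exists n, n.+1%:R^-1 < e :> R.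
    exists (Num.bound e^-1); rewrite invf_plt ?posrE // -natr1 ltr_wpDr //.
    by apply: archi_boundP; rewrite invr_ge0 ltW.
  case: (hB n) => mB _ le; apply: (@le_trans _ _ (P (B n))).
    apply: le_measure; rewrite ?inE //; last exact: bigcap_inf.
    by apply: bigcapT_measurable => k; case: (hB k).
  by apply: (le_trans le); rewrite lee_fin ltW.
- by move=> w Sw n _; case: (hB n) => _ + _; apply.
Qed.

Lemma ae_forall_count (T : countType) (Q : T -> Omega -> Prop) :
  (forall t, {ae P, forall w, Q t w}) -> {ae P, forall w, forall t, Q t w}.
Proof.
move=> aeQ.
have : {ae P, forall w : Omega, forall (n : nat) (t : T), choice.unpickle n = Some t -> Q t w}.
  apply: ae_foralln => n; case: (choice.unpickle n) => [t|]; last exact: aeW.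
  by apply: filterS (aeQ t) => w Qw t' [<-].
by apply: filterS => w + t => /(_ (choice.pickle t)); apply; rewrite choice.pickleK.
Qed.

End Almost.

Section Exploration.
Variables (R : realType) (mu : probability nat R).
Variables (d : measure_display) (Omega : measurableType d) (P : probability Omega R).
Variable k : int -> {RV P >-> nat}.
Hypothesis hlaw : forall (z : int) (A : set nat), measurable A ->
  distribution P (k z) A = mu A.
Hypothesis hindep : mutually_independent k.

Local Notation p := (mass mu).

Definition meet_event (z : int) (a b : nat) : set Omega :=
  [set w | meets (window (fun x => k x w) z) a b].

Lemma meet_event_gt z a b : (b < a)%N -> meet_event z a b =
  \bigcup_(i < a) (meet_event z i b `&` k (z + a%:Z) @^-1` [set m | (m + i)%N = a]).
Proof.
move=> ba; apply/seteqP; split => w; rewrite /meet_event /= meets_gt //.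
  move=> /existsP[i /andP[/eqP ki mi]]; exists (nat_of_ord i); first exact: ltn_ord.
  by split => //=; rewrite -[k _ _]/(window (fun x => k x w) z a) ki subnK // ltnW.
case=> i /= ia [mi ki]; apply/existsP; exists (Ordinal ia); rewrite /= mi andbT.
by rewrite /window -[X in (X - _)%N]ki addnK.
Qed.

Lemma meet_eventC z a b : meet_event z a b = meet_event z b a.
Proof. by apply/seteqP; split => w; rewrite /meet_event /= meetsC. Qed.

Lemma measurable_meet_event z a b : measurable (meet_event z a b).
Proof.
move: a b; apply: meet_ind => [a b|a _|a b ba IH].
- by rewrite meet_eventC.
- rewrite [meet_event _ _ _](_ : _ = setT) //.
  by apply/seteqP; split => w // _; apply: meets_diag.
- rewrite meet_event_gt //; apply: bigcup_measurable => i /= ia.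
  by apply: measurableI; [exact: IH | exact: measurable_funPTI].
Qed.

(** The cylinder over vertices above both lines is what makes the induction
work: fixing the jump of the higher line adds the vertex [z + a] to the
cylinder and leaves a meeting event that involves only lower vertices.  For
the diagonal case nothing but the cylinder remains, and independence
applies. *)
Lemma P_meet_event_cylinder z a b (J : {fset int}) (A : int -> set nat) :
  (forall i, i \in J -> z + (maxn a b)%:Z < i) ->
  P (meet_event z a b `&` \bigcap_(i in [set` J]) (k i @^-1` A i)) =
  ((meet_prob p a b)%:E * \prod_(i <- J) P (k i @^-1` A i))%E.
Proof.
move: a b J A; apply: meet_ind => [a b IH J A|a _ J A _|a b ba IH J A above].
- by rewrite maxnC meet_eventC meet_probC => /IH.
- rewrite meet_prob_diag mul1e -hindep // [meet_event _ _ _](_ : _ = setT) ?setTI //.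
  by apply/seteqP; split => w // _; apply: meets_diag.
pose x := z + a%:Z.
have xJ : x \notin J.
  by apply/negP => /above; rewrite /x; have := leq_maxl a b; lia.
(* [B i] is the event that the jump leads to [z + i]; unlike the singleton of
   [a - i], these sets are disjoint for all natural numbers [i]. *)
pose B (i : nat) : set nat := [set m | (m + i)%N = a].
pose A' (i : nat) (y : int) := if y == x then B i else A y.
have A'E i y : y \in J -> A' i y = A y.
  by move=> yJ; rewrite /A'; case: eqP => // yx; rewrite -yx yJ in xJ.
have A'x i : A' i x = B i by rewrite /A' eqxx.
pose C := \bigcap_(y in [set` J]) (k y @^-1` A y).
pose C' i := \bigcap_(y in [set` (x |` J)%fset]) (k y @^-1` A' i y).
have C'E i : C' i = k x @^-1` B i `&` C.
  rewrite /C' set_fsetU1 bigcap_setU1 A'x; congr (_ `&` _).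
  by apply: eq_bigcapr => y yJ; rewrite A'E.
have mC : measurable C.
  apply: fin_bigcap_measurable => [|y _]; first exact: finite_fset.
  exact: measurable_funPTI.
pose F i := meet_event z i b `&` C' i.
have -> : meet_event z a b `&` C = \big[setU/set0]_(i < a) F i.
  rewrite meet_event_gt // setI_bigcupl bigcup_mkord; apply: eq_bigr => i _.
  by rewrite /F C'E setIA.
rewrite measure_bigsetU; last 2 first.
- move=> i; apply: measurableI; first exact: measurable_meet_event.
  by rewrite C'E; apply: measurableI => //; exact: measurable_funPTI.
- move=> i j _ _ [w [[_ Ci] [_ Cj]]]; move: Ci Cj; rewrite !C'E => -[/= ki _] [/= kj _].
  by apply: (@addnI (k x w)); rewrite ki.
rewrite meet_prob_gt // -sumEFin ge0_sume_distrl => [|i _]; last first.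
  by rewrite lee_fin mulr_ge0 ?mass_ge0 // meet_prob_ge0 // => n; apply: mass_ge0.
apply: eq_bigr => i _; apply: etrans (IH _ (ltn_ord i) _ (A' i) _) _.
  move=> y; have := ltn_ord i; rewrite in_fset1U => ia /predU1P[->|/above]; rewrite /x; lia.
rewrite big_fsetU1 //= A'x mulrC EFinM -muleA; congr (_ * (_ * _))%E.
  have -> : B i = [set (a - i)%N].
    by apply/seteqP; split => m /=; rewrite /B /=; have := ltn_ord i; lia.
  by rewrite -massE -(hlaw x).
by apply: eq_fbigr => y yJ _; rewrite A'E.
Qed.

Lemma P_meet_event z a b : P (meet_event z a b) = (meet_prob p a b)%:E.
Proof.
have := @P_meet_event_cylinder z a b fset0 (fun=> setT).
rewrite set_fset0 bigcap_set0 setIT big_seq_fset0 mule1; apply => i.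
by rewrite in_fset0.
Qed.

End Exploration.

(** * Decay of a regularly varying tail *)
Section Asymptotics.
Variables (R : realType) (alpha : R) (mu : probability nat R).
Hypothesis alpha_gt0 : 0 < alpha.
Hypothesis mu_Gamma : Gamma alpha mu.

Let mu0 : mu [set 0%N] = 0%E. Proof. by case: mu_Gamma. Qed.

Local Notation p := (mass mu).

Lemma tail_mass_gt0 n : 0 < tail p n.
Proof.
case: n => [|n]; first by rewrite /tail big_geq // subr0.
have [_ [L [[L_gt0 _] muE]]] := mu_Gamma.
rewrite -lte_fin -tail_massE // muE // lte_fin mulr_gt0 ?powR_gt0 //.
exact: L_gt0.
Qed.

Lemma tail_mass_ratio (eps : R) : 0 < eps -> exists n0, forall n, (n0 <= n)%N ->
  (2 `^ (- alpha) - eps) * tail p n <= tail p (2 * n) <= (2 `^ (- alpha) + eps) * tail p n.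
Proof.
move=> eps0; have [_ [L [[L_gt0 L_slow] muE]]] := mu_Gamma.
have tailE n : (0 < n)%N -> tail p n = n%:R `^ (- alpha) * L n%:R.
  by move=> n0; apply: EFin_inj; rewrite -tail_massE // muE.
have /cvgrPdist_le /(_ _ eps0) [M [Mreal LM]] := L_slow 1 ltr01.
exists (Num.bound `|M|).+1 => n nM; have n_gt0 : (0 < n)%N by apply: leq_trans nM.
have nR : 0 < n%:R :> R by rewrite ltr0n.
have := LM n%:R; rewrite /= => /(_ _)/wrap[].
  rewrite (le_lt_trans (ler_norm M)) // (lt_trans (archi_boundP (normr_ge0 M))) //.
  by rewrite ltr_nat.
have -> : n%:R * (1 + 1) = (2 * n)%N%:R :> R by rewrite natrM mulrC.
set l := L n%:R; set l2 := L (2 * n)%N%:R => close.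
have l_gt0 : 0 < l by apply: L_gt0.
rewrite !tailE ?muln_gt0 // natrM powRM // -/l.
have -> : L (2%:R * n%:R) = l2 by rewrite /l2 natrM.
move: close; rewrite distrC ler_distl => /andP[]; rewrite ler_pdivlMr // ler_pdivrMr // => lo hi.
have x0 : 0 < 2 `^ (- alpha) :> R by rewrite powR_gt0.
have x1 : 2 `^ (- alpha) <= 1 :> R.
  by rewrite -[leRHS](powRr0 2) ler_powR ?ler1n // oppr_le0 ltW.
have y0 : 0 < n%:R `^ (- alpha) :> R by rewrite powR_gt0.
move: (2 `^ (- alpha)) (n%:R `^ (- alpha)) x0 x1 y0 => x y x0 x1 y0.
have yl : 0 < y * l by rewrite mulr_gt0.
have -> : x * y * l2 = y * (x * l2) by ring.
rewrite ![_ * (y * l)]mulrCA !ler_pM2l //.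
have el : 0 <= (1 - x) * (eps * l) by rewrite !mulr_ge0 ?subr_ge0 // ltW.
have xlo : x * ((1 - eps) * l) <= x * l2 by rewrite ler_pM2l.
have xhi : x * l2 <= x * ((eps + 1) * l) by rewrite ler_pM2l // addrC.
by apply/andP; split; lra.
Qed.

End Asymptotics.

(** * Components of the random graph *)
Lemma powR2_gt1 (R : realType) (c : R) : 0 < c -> 1 < 2 `^ c.
Proof.
move=> c0; rewrite lt_neqAle eq_sym powR_eq1 !negb_or gt_eqF ?ltr1n //= ltNge ler0n /=.
by rewrite (gt_eqF c0) /= -[leLHS](powRr0 2) ler_powR ?ler1n ?(ltW c0).
Qed.

Section Components.
Variables (R : realType) (mu : probability nat R).
Variables (d : measure_display) (Omega : measurableType d) (P : probability Omega R).
Variable k : int -> {RV P >-> nat}.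
Hypothesis mu0 : mu [set 0%N] = 0%E.
Hypothesis hlaw : forall (z : int) (A : set nat), measurable A ->
  distribution P (k z) A = mu A.
Hypothesis hindep : mutually_independent k.

Local Notation p := (mass mu).
Local Notation graph w := (jump_graph (fun z => k z w)).

Lemma ae_same_component z a b : sure_meet p a b ->
  {ae P, forall w, component (graph w) (z + a%:Z) (z + b%:Z)}.
Proof.
move=> meet_ab; apply: negligible_eps => e e0; have [c hc] := meet_ab e e0.
exists (~` meet_event k (z - c%:Z) (a + c) (b + c)); split.
- exact/measurableC/measurable_meet_event.
- move=> w /= ncomp /meets_component; rewrite !PoszD.
  by rewrite [a%:Z + _]addrC [b%:Z + _]addrC !addrA subrK.
rewrite probability_setC; last exact: measurable_meet_event.
by rewrite (P_meet_event hlaw hindep) -EFinB lee_fin; lra.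
Qed.

Lemma ae_one_component : (forall a b, sure_meet p a b) ->
  {ae P, forall w, exists C : set int, components (graph w) = [set C]}.
Proof.
move=> all_meet.
have : {ae P, forall w, forall x : int, component (graph w) 0 x}.
  apply: ae_forall_count => x.
  pose z := - (`|x|%N)%:Z.
  have := ae_same_component z (all_meet `|x|%N `|x - z|%N); apply: filterS => w.
  by congr component; rewrite /z; lia.
apply: filterS => w comp0; exists (component (graph w) 0).
have same x : component (graph w) x = component (graph w) 0.
  apply/seteqP; split => y; first exact: rt_trans (comp0 x).
  by move=> _; apply: rt_trans (comp0 y); apply: component_sym.
apply/seteqP; split => [_ [x _ <-]|_ ->]; first exact: same.
by exists 0.
Qed.

Lemma ae_jumps_gt0 : {ae P, forall w, forall x, (0 < k x w)%N}.
Proof.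
apply: ae_forall_count => x; exists (k x @^-1` [set 0%N]); split.
- exact: measurable_funPTI.
- by rewrite -mu0 -(hlaw x).
- by move=> w /= /negP; rewrite -eqn0Ngt => /eqP.
Qed.

(** The events increase as the base [- c] decreases. *)
Lemma P_ever_meet_le (e : R) a b : (forall c, meet_prob p (a + c) (b + c) <= e) ->
  (P (\bigcup_c meet_event k (- c%:Z) (a + c) (b + c)) <= e%:E)%E.
Proof.
move=> le_e; set F := fun c : nat => _.
have mF c : measurable (F c) by exact: measurable_meet_event.
have ndF : {homo F : m n / (m <= n)%N >-> (m <= n)%O}.
  move=> m n /subnKC <-; elim: (n - m)%N => [|i IHi]; first by rewrite addn0.
  apply: le_trans IHi _; apply/subsetPset => w; rewrite /F /meet_event /= !addnS.
  apply: meets_succ => j; rewrite /window; congr (k _ w); lia.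
have cvgF := nondecreasing_cvg_mu (mu := P) mF (bigcupT_measurable _ mF) ndF.
rewrite -(cvg_lim _ cvgF) //; apply: lime_le.
  by apply/cvg_ex; eexists; exact: cvgF.
by apply: nearW => c /=; rewrite /F (P_meet_event hlaw hindep) lee_fin.
Qed.

(** Place the vertices at the multiples of [D] and apply the union bound to the
fewer than [r * r] pairs. *)
Lemma ae_distinct_components (r : nat) :
  (forall e : R, 0 < e -> exists D, forall a b, (b + D <= a)%N -> meet_prob p a b <= e) ->
  {ae P, forall w, exists x : 'I_r -> int,
    forall i j : 'I_r, (i < j)%N -> ~ component (graph w) (x i) (x j)}.
Proof.
move=> small; set good := fun w : Omega => exists x, _.
suff : {ae P, forall w, (forall x, (0 < k x w)%N) -> good w}.
  by move=> h; apply: filterS2 h ae_jumps_gt0 => w; apply.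
apply: negligible_eps => e e0.
have [D farD] := small (e / (r * r).+1%:R) (divr_gt0 e0 (ltr0Sn _ _)).
pose M (i j : nat) := if (i < j)%N then
  \bigcup_c meet_event k (- c%:Z) (j * D + c) (i * D + c) else set0.
have mM i j : measurable (M i j).
  by rewrite /M; case: ifP => // _; apply: bigcupT_measurable => c; exact: measurable_meet_event.
have PM i j : (P (M i j) <= (e / (r * r).+1%:R)%:E)%E.
  rewrite /M; case: ifP => ij; last by rewrite measure0 lee_fin divr_ge0 // ltW.
  by apply: P_ever_meet_le => c; apply: farD; nia.
have mMs (i : nat) : measurable (\big[setU/set0]_(j < r) M i j) by apply: bigsetU_measurable.
exists (\big[setU/set0]_(i < r) \big[setU/set0]_(j < r) M i j); split.
- by apply: bigsetU_measurable => i _; apply: bigsetU_measurable.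
- move=> w /= /not_implyP[k_gt0 notgood]; apply: contrapT => notM; apply: notgood.
  exists (fun i => (i * D)%N%:Z) => i j ij comp; apply: notM.
  rewrite -(bigcup_mkord r (fun i => \big[setU/set0]_(j < r) M i j)).
  exists (nat_of_ord i) => //=.
  rewrite -(bigcup_mkord r (M i)); exists (nat_of_ord j) => //=.
  rewrite /M ij; have [|c mc] := @component_meets _ k_gt0 0 (i * D) (j * D).
    by rewrite !add0r.
  by exists c => //; rewrite meet_eventC; move: mc; rewrite sub0r.
apply: (@le_trans _ _ (\sum_(i < r) \sum_(j < r) (e / (r * r).+1%:R)%:E)%E).
  have := @Boole_inequality _ _ _ P (fun i => \big[setU/set0]_(j < r) M i j) r.
  move=> /(_ (fun i _ => mMs i)) /le_trans; apply.
  apply: lee_sum => i _; have := @Boole_inequality _ _ _ P (M i) r.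
  move=> /(_ (fun j _ => mM i j)) /le_trans; apply.
  by apply: lee_sum => j _; apply: PM.
rewrite !sumEFin lee_fin !sumr_const !card_ord -mulrnA -[leLHS]mulr_natr.
by rewrite mulrAC ler_pdivrMr // ler_wpM2l ?(ltW e0) // ler_nat.
Qed.

End Components.

Theorem proposition2 (R : realType) (alpha : R) (mu : probability nat R)
    (halpha : 0 < alpha) (hmu : Gamma alpha mu)
    (hgcd : is_gcd (law_support mu) 1)
    (d : measure_display) (Omega : measurableType d) (P : probability Omega R)
    (k : int -> {RV P >-> nat})
    (hlaw : forall (z : int) (A : set nat), measurable A ->
      distribution P (k z) A = mu A)
    (hindep : mutually_independent k) :
  (2^-1 < alpha ->
    {ae P, forall w : Omega, exists C : set int,
      components (jump_graph (fun z => k z w)) = [set C]}) /\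
  (alpha < 2^-1 ->
    {ae P, forall w : Omega,
      infinite_set (components (jump_graph (fun z => k z w)))}).
Proof.
have mu0 : mu [set 0%N] = 0%E by case: hmu.
pose p := mass mu; have p_ge0 : forall n, 0 <= p n := mass_ge0 mu.
have sum_p_le1 : forall n, \sum_(1 <= i < n) p i <= 1 := sum_mass_le1 mu0.
have tail_gt0 : forall n, 0 < tail p n := tail_mass_gt0 hmu.
have p_gcd e : (forall n, (0 < n)%N /\ 0 < p n -> (e %| n)%N) -> (e %| 1)%N.
  move=> dvd_e; apply: hgcd.2 => n mu_n; apply: dvd_e.
  have pn : p n != 0 by move: mu_n; rewrite /law_support /= massE.
  split; last by rewrite lt_neqAle eq_sym pn p_ge0.
  by rewrite lt0n; apply: contra_neq pn => ->; rewrite /p /mass mu0.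
pose x : R := 2 `^ (- alpha).
have x0 : 0 < x by rewrite powR_gt0.
have x1 : x < 1.
  by rewrite /x powRN invf_lt1 ?powR_gt0 // powR2_gt1.
have x_sqr (c : R) : 2 `^ c * (2 * x ^+ 2) = 2 `^ (c + (1 - 2 * alpha)).
  have -> : c + (1 - 2 * alpha) = c + (1 + (- alpha + - alpha)) by ring.
  by rewrite !powRD ?pnatr_eq0 ?implybT // powRr1.
have ratio := tail_mass_ratio halpha hmu.
split=> half.
- have c0 : 0 < 2 * alpha - 1 by lra.
  have xx : 2 * x ^+ 2 < 1.
    have := x_sqr (2 * alpha - 1).
    rewrite (_ : 2 * alpha - 1 + _ = 0) ?powRr0; last by ring.
    have := powR2_gt1 c0; move: (2 `^ _) => y y1 e; rewrite ltNge; apply/negP => t1.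
    by nra.
  (* The decay rate must exceed both [x] and [1 / 2] and have a square below
     [1 / 2]; the margin [dl] is small enough for [y + dl] because [y < 1]. *)
  pose y := Num.max x 2^-1.
  have [y2 y1 yy xy] : [/\ 2^-1 <= y, y < 1, 2 * y ^+ 2 < 1 & x <= y].
    by rewrite /y; case: (leP x 2^-1) => h; split; rewrite ?expr2; lra.
  pose dl := (1 - 2 * y ^+ 2) / 8; have dl0 : 0 < dl by rewrite /dl; lra.
  have dl1 : dl < 1 / 8 by rewrite /dl; nra.
  have rho_lt : 2 * (y + dl) ^+ 2 < 1 by rewrite (_ : 1 = 2 * y ^+ 2 + 8 * dl) /dl; [nra | field].
  have [n0 hn0] := ratio dl dl0.
  have decay n : (n0 <= n)%N -> tail p (2 * n) <= (y + dl) * tail p n.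
    move=> /hn0/andP[_ h]; apply: le_trans h _.
    by rewrite ler_pM2r ?tail_gt0 // lerD2r.
  apply: (ae_one_component hlaw hindep); apply: (sure_meetT p_ge0 sum_p_le1 _ rho_lt decay) => //.
    by lra.
  by apply: support_unbounded decay => //; nra.
- have xx : 1 < 2 * x ^+ 2.
    have := x_sqr 0; rewrite powRr0 mul1r add0r => ->; apply: powR2_gt1; lra.
  pose dl := (2 * x ^+ 2 - 1) / 8; have dl0 : 0 < dl by rewrite /dl; lra.
  have dl1 : dl < 1 / 8 by rewrite /dl; nra.
  have xlo : 2^-1 < x by nra.
  (* The first bound keeps [2 * (x - e) ^+ 2] above [1], the second one keeps
     [x + e] below [1]. *)
  pose e := Num.min dl ((1 - x) / 2).
  have e0 : 0 < e by rewrite lt_min dl0 divr_gt0 // subr_gt0.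
  have e_dl : e <= dl by rewrite ge_min lexx.
  have e_x : e <= (1 - x) / 2 by rewrite ge_min lexx orbT.
  have [n0 hn0] := ratio e e0.
  have rho_gt : 1 < 2 * (x - e) ^+ 2.
    have dlE : 8 * dl = 2 * x ^+ 2 - 1 by rewrite /dl; field.
    by nra.
  have [B hB] := renewal_sqr_summable p_ge0 sum_p_le1 rho_gt
    (ltac:(lra) : 0 < x - e) (ltac:(lra) : x - e < 1) (ltac:(lra) : x + e < 1) tail_gt0 hn0 p_gcd.
  have far e' : 0 < e' -> exists D, forall a b, (b + D <= a)%N -> meet_prob p a b <= e'.
    by move=> e'0; apply: (meet_prob_small p_ge0 e'0 hB).
  have := ae_foralln (fun r => ae_distinct_components mu0 hlaw hindep r far).
  by apply: filterS => w distinct; apply: infinite_components.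
Qed.
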